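(* There is a real constant $C>0$ such that for every $L^1(T)$-bounded martingale $f$ with respect to $(T_n)_{n\ge1}$ and every real $\lambda>0$: (i) $\lambda\, TP_{(f^*-\lambda e)^+}\,e\le C\|f\|_1$; (ii) $\lambda\, TP_{(S(f)-\lambda e)^+}\,e\le C\|f\|_1$.
   Context: $E$ is a Dedekind complete Riesz space with weak order unit $e>0$. A conditional expectation on $E$ is a strictly positive order-continuous linear projection $S:E\to E$ whose range $R(S)$ is a Dedekind complete Riesz subspace of $E$ and with $Se=e$. A filtration is a sequence $(T_i)_{i\ge1}$ of conditional expectations with $T_iT_j=T_jT_i=T_j$ for $j\le i$; put $T=T_1$. $E_u$ is the universal completion of $E$, with its $f$-algebra structure in which $e$ is the multiplicative unit. $E_s$ is the sup-completion of $E$: the unique Dedekind complete ordered cone with a largest element containing $E$ as the sub-cone equal to its group of invertible elements, such that $x=\sup\{g\in E:g\le x\}$ for $x\in E_s$; positive elements of $E_u$ are regarded as elements of $E_s$. For $x\in E_s$ positive, $Tx:=\sup_\alpha Tx_\alpha\in E_s$ for any increasing net $(x_\alpha)$ in $E^+$ with $x_\alpha\uparrow x$. $L^1(T)$ is the natural domain of $T$: the $x\in E_u$ with $T|x|\in E_u$; it is a Dedekind complete Riesz space with weak order unit $e$, and all $T_i$ extend to conditional expectations on it (same notation). A martingale is a sequence $f=(f_n)_{n\ge1}$ in $L^1(T)$ with $f_n\in R(T_n)$ and $T_if_j=f_i$ for $i\le j$. Put $\Delta f_1=f_1$, $\Delta f_n=f_n-f_{n-1}$ $(n\ge2)$, $f^*=\sup_n|f_n|\in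 E_s$, $S(f)=\sup_n\left(\sum_{k=1}^n(\Delta f_k)^2\right)^{1/2}\in E_s$, $\|f\|_1=\sup_nT|f_n|$. $f$ is $L^1(T)$-bounded if this last supremum exists in $L^1(T)$. For positive $x\in E$ (or $x\in E_s$), $P_x$ is the band projection of $E$ onto the band generated by $x$ (respectively by $\{g\in E:0\le g\le x\}$); for $x\in E_s$ positive, $(x-\lambda e)^+=\sup\{(g-\lambda e)^+:g\in E,\ 0\le g\le x\}$. *)

(* Defs.v *)
From HB Require Import structures.
From mathcomp Require Import all_boot all_order all_algebra.
From mathcomp Require Import all_classical reals.
Set Implicit Arguments.
Unset Strict Implicit.
Unset Printing Implicit Defensive.
Import Order.TTheory GRing.Theory Num.Theory.
Local Open Scope classical_set_scope.
Local Open Scope ring_scope.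

(* The lattice operations are carried by the mixin, not inherited from
   Order.Lattice: the join of Order.Lattice with GRing.Zmodule cannot be
   declared below Num.RealDomain any more. *)
HB.mixin Record isRieszSpace (R : numDomainType) E
    of GRing.Lmodule R E & Order.POrder ring_display E := {
  riesz_leD2r : forall z x y : E, x <= y -> x + z <= y + z;
  riesz_leZ : forall (a : R) (x y : E), 0 <= a -> x <= y -> a *: x <= a *: y;
  rjoin : E -> E -> E;
  rmeet : E -> E -> E;
  rjoin_le : forall x y z : E, (rjoin x y <= z) = (x <= z) && (y <= z);
  rmeet_ge : forall x y z : E, (z <= rmeet x y) = (z <= x) && (z <= y)
}.

#[short(type="rieszType")]
HB.structure Definition RieszSpace (R : numDomainType) :=
  { E of GRing.Lmodule R E & Order.POrder ring_display E & isRieszSpace R E }.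

(* s is the least upper bound of A in the subset D *)
Definition sup_in d (X : porderType d) (D A : set X) (s : X) : Prop :=
  [/\ D s, ubound A s & forall t, D t -> ubound A t -> (s <= t)%O].

Definition dedekind_complete d (X : porderType d) (D : set X) : Prop :=
  forall A : set X, A `<=` D -> A !=set0 -> (exists2 u, D u & ubound A u) ->
    exists s, sup_in D A s.

Section Riesz.
Variables (R : numDomainType) (E : rieszType R).
Implicit Types (x y l e : E) (A B D : set E).

Definition rabs x := rjoin x (- x).
Definition rpos x := rjoin x 0.
Definition rneg x := rjoin (- x) 0.
Definition rdisjoint x y : Prop := rmeet (rabs x) (rabs y) = 0.

Definition linear_subspace D : Prop :=
  [/\ D 0, forall x y, D x -> D y -> D (x + y)
   & forall (a : R) x, D x -> D (a *: x)].

Definition riesz_subspace D : Prop :=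
  [/\ linear_subspace D, forall x y, D x -> D y -> D (rjoin x y)
   & forall x y, D x -> D y -> D (rmeet x y)].

Definition is_band B : Prop :=
  [/\ linear_subspace B,
      forall x y, B y -> rabs x <= rabs y -> B x
    & forall A s, A `<=` B -> supremums A s -> B s].

Definition band_gen A : set E :=
  \bigcap_(B in [set B | is_band B /\ A `<=` B]) B.

(* the component of x in the band generated by A, along its disjoint
   complement *)
Definition band_proj A x : E :=
  xget 0 [set y | band_gen A y /\
                  forall b, band_gen A b -> rdisjoint (x - y) b].

Definition weak_order_unit e : Prop := 0 < e /\ band_gen [set e] = setT.

Definition directed (I : Type) (r : I -> I -> Prop) : Prop :=
  [/\ inhabited I, forall a, r a a,
      forall a b c, r a b -> r b c -> r a c
    & forall a b, exists2 c, r a c & r b c].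

Definition order_cvg (I : Type) (r : I -> I -> Prop) (x : I -> E) l : Prop :=
  exists y : I -> E,
    [/\ forall a b, r a b -> y b <= y a, infimums (range y) 0
      & forall a, rabs (x a - l) <= y a].

Definition order_continuous (S : E -> E) : Prop :=
  forall (I : Type) (r : I -> I -> Prop) (x : I -> E) l,
    directed r -> order_cvg r x l -> order_cvg r (S \o x) (S l).

Record cond_expectation e (S : {linear E -> E}) : Prop := {
  ce_strictly_pos : forall x, 0 < x -> 0 < S x;
  ce_order_continuous : order_continuous S;
  ce_idem : forall x, S (S x) = S x;
  ce_range_riesz : riesz_subspace (range S);
  ce_range_dedekind : dedekind_complete (range S);
  ce_unit : S e = e
}.

(* Indices start at 0: T 0 is the first conditional expectation. *)
Definition filtration e (T : nat -> {linear E -> E}) : Prop :=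
  (forall n, cond_expectation e (T n)) /\
  forall m n x, (m <= n)%N -> T n (T m x) = T m x /\ T m (T n x) = T m x.

(* Commutativity is automatic for Archimedean f-algebras. *)
Record f_algebra (mul : E -> E -> E) (one : E) : Prop := {
  falg_mulA : forall x y z, mul x (mul y z) = mul (mul x y) z;
  falg_mulC : forall x y, mul x y = mul y x;
  falg_mulDl : forall x y z, mul (x + y) z = mul x z + mul y z;
  falg_mulZl : forall (a : R) x y, mul (a *: x) y = a *: mul x y;
  falg_mul1 : forall x, mul one x = x;
  falg_mul_ge0 : forall x y, 0 <= x -> 0 <= y -> 0 <= mul x y;
  falg_mul_disj : forall x y z, 0 <= z ->
    rmeet x y = 0 -> rmeet (mul z x) y = 0
}.

Definition laterally_complete : Prop :=
  forall A, A !=set0 -> (forall x, A x -> 0 <= x) ->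
    (forall x y, A x -> A y -> x <> y -> rdisjoint x y) ->
    exists s, supremums A s.

Definition universally_complete : Prop :=
  dedekind_complete [set: E] /\ laterally_complete.

End Riesz.

Arguments universally_complete {R} E.

Record universal_completion (R : numDomainType) (E U : rieszType R)
    (j : {linear E -> U}) : Prop := {
  uc_complete : universally_complete U;
  uc_inj : injective j;
  uc_join : forall x y, j (rjoin x y) = rjoin (j x) (j y);
  uc_order_dense : forall u, 0 < u -> exists x, 0 < j x /\ j x <= u
}.

(* Only scalars a >= 0 are meaningful in cscale. *)
HB.mixin Record isOrderedCone (R : numDomainType) S
    of Order.POrder ring_display S := {
  czero : S;
  cadd : S -> S -> S;
  cscale : R -> S -> S;
  caddA : forall x y z : S, cadd x (cadd y z) = cadd (cadd x y) z;
  caddC : forall x y : S, cadd x y = cadd y x;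
  cadd0 : forall x : S, cadd czero x = x;
  cscaleA : forall (a b : R) (x : S), 0 <= a -> 0 <= b ->
    cscale a (cscale b x) = cscale (a * b) x;
  cscale0 : forall x : S, cscale 0 x = czero;
  cscale1 : forall x : S, cscale 1 x = x;
  cscaleDr : forall (a : R) (x y : S), 0 <= a ->
    cscale a (cadd x y) = cadd (cscale a x) (cscale a y);
  cscaleDl : forall (a b : R) (x : S), 0 <= a -> 0 <= b ->
    cscale (a + b) x = cadd (cscale a x) (cscale b x);
  cone_leD2r : forall z x y : S, x <= y -> cadd x z <= cadd y z;
  cone_leZ : forall (a : R) (x y : S), 0 <= a -> x <= y ->
    cscale a x <= cscale a y
}.

#[short(type="orderedConeType")]
HB.structure Definition OrderedCone (R : numDomainType) :=
  { S of Order.POrder ring_display S & isOrderedCone R S }.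

(* Completeness, a largest element, E as the invertible elements and approxi-
   mation from below do not determine the cone: R^2 together with a single
   infinite element has all these properties, and so does R together with an
   infinite element and, for each real r, an element just below r. The usual
   further properties of Donner's sup-completion exclude this: E is solid,
   suprema are compatible with addition, and suprema of subsets of E satisfy
   the infinite distributive law. *)
Record sup_completion (R : numDomainType) (E : rieszType R)
    (S : orderedConeType R) (i : E -> S) : Prop := {
  sc_add : forall x y, i (x + y) = cadd (i x) (i y);
  sc_scale : forall (a : R) x, 0 <= a -> i (a *: x) = cscale a (i x);
  sc_le : forall x y, (i x <= i y) = (x <= y);
  sc_dedekind : dedekind_complete [set: S];
  sc_top : exists t : S, forall s, s <= t;
  sc_invertible : forall s,
    (exists t, cadd s t = czero) <-> (exists x, s = i x);
  sc_minorant : forall s, exists x, i x <= s;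
  sc_approx : forall s, supremums [set i x | x in [set x | i x <= s]] s;
  sc_solid : forall s y, s <= i y -> exists x, s = i x;
  sc_sup_add : forall (A : set S) (s t : S), A !=set0 ->
    supremums A s -> supremums [set cadd t a | a in A] (cadd t s);
  sc_sup_meet : forall (A : set E) (s : S) (x : E), A !=set0 ->
    supremums [set i a | a in A] s -> i x <= s ->
    supremums [set rmeet x a | a in A] x
}.

Section Martingales.
Variables (R : realType) (E U : rieszType R) (S : orderedConeType R).
Variables (i : E -> S) (j : {linear E -> U}) (mul : U -> U -> U) (e : E).
Implicit Types (P : {linear E -> E}) (T : nat -> {linear E -> E}).
Implicit Types (u : U) (s : S) (f : nat -> U).

Definition below s : set E := [set g | 0 <= g /\ i g <= s].

(* the element of E_s represented by a positive u in E_u *)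
Definition u_to_s u : S :=
  supremum (i 0) [set i g | g in [set g | 0 <= g /\ j g <= u]].

Definition in_Eu s : Prop := exists2 u, 0 <= u & u_to_s u = s.

(* the positive element of E_u representing s, when there is one *)
Definition s_to_u s : U := xget 0 [set u | 0 <= u /\ u_to_s u = s].

(* The value on a positive s, along the increasing net of all g in E with
   0 <= g <= s. *)
Definition ext_s P s : S := supremum (i 0) [set i (P g) | g in below s].

Definition L1 P : set U := [set u | in_Eu (ext_s P (u_to_s (rabs u)))].

(* Meaningful on L1 (T 0), for every P = T n of a filtration T. *)
Definition ext P u : U :=
  s_to_u (ext_s P (u_to_s (rpos u))) - s_to_u (ext_s P (u_to_s (rneg u))).

Record martingale T f : Prop := {
  mart_L1 : forall n, L1 (T 0%N) (f n);
  mart_adapted : forall n, [set ext (T n) u | u in L1 (T 0%N)] (f n);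
  mart_proj : forall m n, (m <= n)%N -> ext (T m) (f n) = f m
}.

Definition L1_norms T f : set U := range (fun n => ext (T 0%N) (rabs (f n))).

Definition L1_bounded T f : Prop :=
  exists u, sup_in (L1 (T 0%N)) (L1_norms T f) u.

Definition norm1 T f : U := xget 0 (sup_in (L1 (T 0%N)) (L1_norms T f)).

Definition mdiff f (n : nat) : U := if n is m.+1 then f n - f m else f 0%N.

Definition rsqrt u : U := xget 0 [set v | 0 <= v /\ mul v v = u].

Definition maximal_fun f : S :=
  supremum (i 0) (range (fun n => u_to_s (rabs (f n)))).

Definition square_fun f : S :=
  supremum (i 0) (range (fun n =>
    u_to_s (rsqrt (\sum_(k < n.+1) mul (mdiff f k) (mdiff f k))))).

(* (s - lambda e)^+ *)
Definition excess s (lambda : R) : S :=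
  supremum (i 0) [set i (rpos (g - lambda *: e)) | g in below s].

Definition band_proj_s s : E -> E := band_proj (below s).

End Martingales.

(* Main.v *)
Require Import Defs.
From HB Require Import structures.
From mathcomp Require Import all_boot all_order all_algebra.
From mathcomp Require Import all_classical reals.
From mathcomp Require Import ring.
Set Implicit Arguments.
Unset Strict Implicit.
Unset Printing Implicit Defensive.
Import Order.TTheory GRing.Theory Num.Theory.
Local Open Scope classical_set_scope.
Local Open Scope ring_scope.

(** Both inequalities come from one stopping argument at a finite horizon N,
   followed by a passage to the supremum over N.

   The universal completion, with its multiplication, is a Dedekind complete
   f-algebra whose unit is the image of e. The base space embeds in it as an
   order dense ideal, and indicators become idempotents: chi u is the indicator
   of the set where u is positive. There the conditional expectations T_n act
   on the ideal and extend to a positive a through the supremum of T_n x over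
   the x in the ideal with 0 <= x <= a (expect).

   Two facts about conditional expectations carry the proof. The averaging
   property T_n (p y) = p T_n y for bounded p in the range of T_n (cx_avg) is
   obtained from the Jensen inequality T_n (y^2) >= (T_n y)^2 by expanding it at
   y + s p for all real s. If T_0 is finite at a positive F, then so is every
   T_n (expect_exists): on a part of the space where T_n F is infinite, strict
   positivity makes T_0 (T_n F) = T_0 F infinite as well, and elsewhere lateral
   completeness glues the local bounds.

   Write f_n = a_n - b_n for n <= N, where a_n and b_n are the conditional
   expectations of the positive and of the negative part of f_N, and let
   m_n = a_n + b_n, which dominates |f_n|. Stop at the first n with
   m_n > lambda, and let q_n be the indicator that this has not happened up to
   time n. On the part 1 - q_N the stopped majorant exceeds lambda, hence
   lambda T_0 (1 - q_N) <= T_0 m_N = T_0 |f_N| <= |f|_1. This is (i).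

   For (ii), with Q_n the sum of the squares of the first increments,
   Q_n - f_n^2 changes from n-1 to n by -2 f_{n-1} (f_n - f_{n-1}). Before
   stopping, the multiplier q_{n-1} f_{n-1} is bounded by lambda, so these terms
   have expectation zero; the term at the time of stopping adds at most
   2 lambda m_n. Altogether T_0 (q_N Q_N) <= 2 lambda |f|_1
   (stopped_estimate), and Markov gives lambda T_0 (q_N d) <= 2 |f|_1 for the
   indicator d of Q_N > lambda^2. Adding the part 1 - q_N gives the constant 3
   (weak_square).

   Finally, the band of the excess of a supremum over n is controlled by the
   indicators of the excesses of its finitely many first terms, and T_0 is
   order continuous (weak_type_sup). *)

(** * Riesz spaces *)

Section RieszOrder.
Variables (R : realType) (E : rieszType R).
Implicit Types (x y z a b c : E) (X Y : set E).

Lemma rleD2r z x y : (x + z <= y + z) = (x <= y).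
Proof.
apply/idP/idP => [h|]; last exact: riesz_leD2r.
by have := riesz_leD2r (- z) _ _ h; rewrite !addrK.
Qed.

Lemma rleD2l z x y : (z + x <= z + y) = (x <= y).
Proof. by rewrite ![z + _]addrC rleD2r. Qed.

Lemma rleD x y a b : x <= y -> a <= b -> x + a <= y + b.
Proof. by move=> xy ab; apply: le_trans (_ : y + a <= _); rewrite ?rleD2r ?rleD2l. Qed.

Lemma rsub_ge0 x y : (0 <= y - x) = (x <= y).
Proof. by rewrite -[LHS](rleD2r x) add0r subrK. Qed.

Lemma rsub_le0 x y : (x - y <= 0) = (x <= y).
Proof. by rewrite -[LHS](rleD2r y) add0r subrK. Qed.

Lemma rleN2 x y : (- x <= - y) = (y <= x).
Proof. by rewrite -[LHS]rsub_ge0 opprK addrC rsub_ge0. Qed.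

Lemma rleBlDr x y z : (x - y <= z) = (x <= z + y).
Proof. by rewrite -[LHS](rleD2r y) subrK. Qed.

Lemma rleBrDr x y z : (x <= y - z) = (x + z <= y).
Proof. by rewrite -[LHS](rleD2r z) subrK. Qed.

Lemma raddr_ge0 x y : 0 <= x -> 0 <= y -> 0 <= x + y.
Proof. by move=> x0 y0; rewrite -(addr0 0); apply: rleD. Qed.

Lemma rle_addr x y : 0 <= y -> x <= x + y.
Proof. by move=> y0; rewrite -{1}(addr0 x) rleD2l. Qed.

Lemma rle_addl x y : 0 <= y -> x <= y + x.
Proof. by move=> y0; rewrite addrC; apply: rle_addr. Qed.

Lemma roppr_le0 x : (- x <= 0) = (0 <= x).
Proof. by rewrite -[in LHS]oppr0 rleN2. Qed.

Lemma roppr_ge0 x : (0 <= - x) = (x <= 0).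
Proof. by rewrite -[in LHS]oppr0 rleN2. Qed.

Lemma rscale_ge0 (k : R) x : 0 <= k -> 0 <= x -> 0 <= k *: x.
Proof. by move=> k0 x0; rewrite -(scaler0 _ k); apply: riesz_leZ. Qed.

Lemma rscale_le (k : R) x y : 0 < k -> (k *: x <= k *: y) = (x <= y).
Proof.
move=> k0; apply/idP/idP => [h|]; last by apply: riesz_leZ; apply: ltW.
have := @riesz_leZ _ _ k^-1 _ _ _ h; rewrite !scalerA mulVf ?gt_eqF// !scale1r.
by apply; rewrite invr_ge0 ltW.
Qed.

Lemma rscale_le2 (k l : R) x : k <= l -> 0 <= x -> k *: x <= l *: x.
Proof. by move=> kl x0; rewrite -rsub_ge0 -scalerBl rscale_ge0// subr_ge0. Qed.

Lemma rle_joinl x y : x <= rjoin x y.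
Proof. by have := lexx (rjoin x y); rewrite rjoin_le => /andP[]. Qed.

Lemma rle_joinr x y : y <= rjoin x y.
Proof. by have := lexx (rjoin x y); rewrite rjoin_le => /andP[]. Qed.

Lemma rmeet_lel x y : rmeet x y <= x.
Proof. by have := lexx (rmeet x y); rewrite rmeet_ge => /andP[]. Qed.

Lemma rmeet_ler x y : rmeet x y <= y.
Proof. by have := lexx (rmeet x y); rewrite rmeet_ge => /andP[]. Qed.

Lemma rjoinC x y : rjoin x y = rjoin y x.
Proof. by apply/le_anti; rewrite !rjoin_le !rle_joinl !rle_joinr. Qed.

Lemma rmeetC x y : rmeet x y = rmeet y x.
Proof. by apply/le_anti; rewrite !rmeet_ge !rmeet_lel !rmeet_ler. Qed.

Lemma rjoin_mono x y a b : x <= y -> a <= b -> rjoin x a <= rjoin y b.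
Proof.
by move=> xy ab; rewrite rjoin_le (le_trans xy (rle_joinl _ _)) (le_trans ab (rle_joinr _ _)).
Qed.

Lemma rmeet_mono x y a b : x <= y -> a <= b -> rmeet x a <= rmeet y b.
Proof.
by move=> xy ab; rewrite rmeet_ge (le_trans (rmeet_lel _ _) xy) (le_trans (rmeet_ler _ _) ab).
Qed.

Lemma rjoin_l x y : y <= x -> rjoin x y = x.
Proof. by move=> yx; apply/le_anti; rewrite rjoin_le lexx yx rle_joinl. Qed.

Lemma rjoin_r x y : x <= y -> rjoin x y = y.
Proof. by move=> yx; rewrite rjoinC rjoin_l. Qed.

Lemma rmeet_l x y : x <= y -> rmeet x y = x.
Proof. by move=> xy; apply/le_anti; rewrite rmeet_ge lexx xy rmeet_lel. Qed.

Lemma rmeet_r x y : y <= x -> rmeet x y = y.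
Proof. by move=> xy; rewrite rmeetC rmeet_l. Qed.

Lemma rjoinDr x y z : rjoin x y + z = rjoin (x + z) (y + z).
Proof.
apply/le_anti/andP; split; last by rewrite rjoin_le !rleD2r rle_joinl rle_joinr.
by rewrite -rleBrDr rjoin_le !rleBrDr rle_joinl rle_joinr.
Qed.

Lemma rmeetDr x y z : rmeet x y + z = rmeet (x + z) (y + z).
Proof.
apply/le_anti/andP; split; first by rewrite rmeet_ge !rleD2r rmeet_lel rmeet_ler.
by rewrite -rleBlDr rmeet_ge !rleBlDr rmeet_lel rmeet_ler.
Qed.

Lemma roppr_join x y : - rjoin x y = rmeet (- x) (- y).
Proof.
apply/le_anti/andP; split; first by rewrite rmeet_ge !rleN2 rle_joinl rle_joinr.
have h (u v : E) : (u <= - v) = (v <= - u) by rewrite -[LHS]rleN2 opprK.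
by rewrite h rjoin_le h rmeet_lel h rmeet_ler.
Qed.

Lemma rjoin_meet x y : rjoin x y + rmeet x y = x + y.
Proof.
have -> : rmeet x y = - rjoin (- x) (- y) by rewrite roppr_join !opprK.
apply/eqP; rewrite subr_eq; apply/eqP.
have -> : rjoin x y = rjoin (- x) (- y) + (x + y).
  by rewrite rjoinDr addrA addNr add0r [x + y]addrC addrA addNr add0r rjoinC.
by rewrite addrC.
Qed.

Lemma rjoinZ (k : R) x y : 0 < k -> k *: rjoin x y = rjoin (k *: x) (k *: y).
Proof.
move=> k0; apply/le_anti/andP; split; last by rewrite rjoin_le !rscale_le// rle_joinl rle_joinr.
have e z : z = k *: (k^-1 *: z) by rewrite scalerA mulfV ?gt_eqF// scale1r.
rewrite [X in _ <= X]e rscale_le// rjoin_le.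
by apply/andP; split; rewrite -(rscale_le _ _ k0) -e ?rle_joinl ?rle_joinr.
Qed.

Lemma rpos_ge0 x : 0 <= rpos x. Proof. exact: rle_joinr. Qed.
Lemma rneg_ge0 x : 0 <= rneg x. Proof. exact: rle_joinr. Qed.
Lemma rle_pos x : x <= rpos x. Proof. exact: rle_joinl. Qed.

Lemma rpos_id x : 0 <= x -> rpos x = x. Proof. exact: rjoin_l. Qed.
Lemma rneg_0 x : 0 <= x -> rneg x = 0.
Proof. by move=> x0; apply: rjoin_r; rewrite roppr_le0. Qed.

Lemma rpos_mono x y : x <= y -> rpos x <= rpos y.
Proof. by move=> xy; apply: rjoin_mono. Qed.

Lemma rposBneg x : rpos x - rneg x = x.
Proof.
apply/eqP; rewrite subr_eq; apply/eqP.
by rewrite /rpos /rneg addrC rjoinDr addNr add0r rjoinC.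
Qed.

Lemma rpos_meet_neg x : rmeet (rpos x) (rneg x) = 0.
Proof.
have -> : rpos x = x + rneg x by rewrite -{2}(rposBneg x) subrK.
rewrite -{2}[rneg x]add0r -rmeetDr.
have -> : rmeet x 0 = - rneg x by rewrite /rneg roppr_join opprK oppr0.
by rewrite addNr.
Qed.

Lemma rabs_posneg x : rabs x = rpos x + rneg x.
Proof.
have -> : rabs x = rjoin (2 *: x) 0 - x.
  by rewrite rjoinDr add0r scaler_nat mulr2n addrK.
rewrite -[X in rjoin _ X](scaler0 _ (2 : R)) -rjoinZ// -/(rpos x).
by rewrite -{2}(rposBneg x) scaler_nat mulr2n opprB addrA [rpos x + rpos x + _]addrAC addrK.
Qed.

Lemma rabs_ge0 x : 0 <= rabs x.
Proof. by rewrite rabs_posneg raddr_ge0// ?rpos_ge0// rneg_ge0. Qed.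

Lemma rle_abs x : x <= rabs x. Proof. exact: rle_joinl. Qed.
Lemma rleN_abs x : - x <= rabs x. Proof. exact: rle_joinr. Qed.

Lemma rabs_le x y : (rabs x <= y) = (x <= y) && (- x <= y).
Proof. exact: rjoin_le. Qed.

Lemma rabs_id x : 0 <= x -> rabs x = x.
Proof. by move=> x0; rewrite rabs_posneg rpos_id// rneg_0// addr0. Qed.

Lemma rabsN x : rabs (- x) = rabs x.
Proof. by rewrite /rabs opprK rjoinC. Qed.

Lemma rabsD x y : rabs (x + y) <= rabs x + rabs y.
Proof. by rewrite rabs_le opprD !rleD// ?rle_abs// rleN_abs. Qed.

Lemma rmeet_ge0 x y : 0 <= x -> 0 <= y -> 0 <= rmeet x y.
Proof. by move=> x0 y0; rewrite rmeet_ge x0 y0. Qed.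

Lemma rmeet0_le x y a b : 0 <= x -> 0 <= a -> x <= y -> a <= b ->
  rmeet y b = 0 -> rmeet x a = 0.
Proof.
move=> x0 a0 xy ab h; apply/le_anti; rewrite rmeet_ge0// andbT -h.
exact: rmeet_mono.
Qed.

(** Subadditivity of the meet with a fixed positive element; it makes
   disjointness from that element stable under sums. *)
Lemma rmeetD_le x y z : 0 <= x -> 0 <= y -> 0 <= z ->
  rmeet (x + y) z <= rmeet x z + rmeet y z.
Proof.
move=> x0 y0 z0; rewrite rmeetDr rmeet_ge; apply/andP; split.
  rewrite [x + rmeet y z]addrC rmeetDr rmeet_ge; apply/andP; split.
    by rewrite [y + x]addrC; exact: rmeet_lel.
  by apply: le_trans (rmeet_ler _ _) _; apply: rle_addr.
by apply: le_trans (rmeet_ler _ _) _; apply: rle_addr; rewrite rmeet_ge0.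
Qed.

Lemma rmeet0D x y z : 0 <= x -> 0 <= y -> 0 <= z ->
  rmeet x z = 0 -> rmeet y z = 0 -> rmeet (x + y) z = 0.
Proof.
move=> x0 y0 z0 hx hy; apply/le_anti; rewrite rmeet_ge0 ?raddr_ge0// andbT.
by apply: le_trans (rmeetD_le x0 y0 z0) _; rewrite hx hy addr0.
Qed.

Lemma rmeet0Mn n x z : 0 <= x -> 0 <= z -> rmeet x z = 0 -> rmeet (n%:R *: x) z = 0.
Proof.
move=> x0 z0 h; elim: n => [|n IH]; first by rewrite scale0r rmeet_l.
rewrite -natr1 scalerDl scale1r rmeet0D// rscale_ge0//.
Qed.

Lemma rmeet0Z (k : R) x z : 0 <= k -> 0 <= x -> 0 <= z -> rmeet x z = 0 ->
  rmeet (k *: x) z = 0.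
Proof.
move=> k0 x0 z0 h.
apply: (@rmeet0_le _ ((Num.truncn k).+1%:R *: x) _ z) => //; rewrite ?rscale_ge0//.
  by apply: rscale_le2 => //; rewrite ltW// truncnS_gt.
exact: rmeet0Mn.
Qed.

(** * Suprema in Riesz spaces *)

Lemma sups_uniq X a b : supremums X a -> supremums X b -> a = b.
Proof. by move=> ha hb; apply: (is_subset1_supremums ha hb). Qed.

Lemma sups_ub X a x : supremums X a -> X x -> x <= a.
Proof. by move=> [h _] /h. Qed.

Lemma sups_le X a b : supremums X a -> (forall x, X x -> x <= b) -> a <= b.
Proof. by move=> [_ h] hb; apply: h => x /hb. Qed.

Lemma mk_sups X a : (forall x, X x -> x <= a) ->
  (forall b, (forall x, X x -> x <= b) -> a <= b) -> supremums X a.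
Proof. by move=> h1 h2; split=> [x /h1//|b hb]; apply: h2 => x /hb. Qed.

Lemma sups_addr X a c : supremums X a -> supremums [set x + c | x in X] (a + c).
Proof.
move=> h; apply: mk_sups => [_ [x Xx <-]|b hb]; first by rewrite rleD2r (sups_ub h).
rewrite -rleBrDr; apply: (sups_le h) => x Xx; rewrite rleBrDr; apply: hb.
by exists x.
Qed.

Lemma sups_scale X a (k : R) : 0 < k -> supremums X a ->
  supremums [set k *: x | x in X] (k *: a).
Proof.
move=> k0 h; apply: mk_sups => [_ [x Xx <-]|b hb]; first by rewrite rscale_le// (sups_ub h).
have e z : z = k *: (k^-1 *: z) by rewrite scalerA mulfV ?gt_eqF// scale1r.
rewrite [b]e rscale_le//; apply: (sups_le h) => x Xx.
by rewrite -(rscale_le _ _ k0) -e; apply: hb; exists x.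
Qed.

Lemma sups_join X a c : X !=set0 -> supremums X a ->
  supremums [set rjoin x c | x in X] (rjoin a c).
Proof.
move=> [x0 X0] h; apply: mk_sups => [_ [x Xx <-]|b hb].
  by apply: rjoin_mono => //; apply: (sups_ub h).
rewrite rjoin_le; apply/andP; split; last first.
  by apply: le_trans (rle_joinr x0 c) (hb _ _); exists x0.
apply: (sups_le h) => x Xx; apply: le_trans (rle_joinl x c) (hb _ _).
by exists x.
Qed.

(** The infinite distributive law. *)
Lemma sups_meet X a c : supremums X a ->
  supremums [set rmeet x c | x in X] (rmeet a c).
Proof.
move=> h; apply: mk_sups => [_ [x Xx <-]|b hb].
  by apply: rmeet_mono => //; apply: (sups_ub h).
have e x : rmeet x c = x + c - rjoin x c by rewrite -(rjoin_meet x c) addrAC subrr add0r.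
rewrite e rleBlDr -rleBrDr; apply: (sups_le h) => x Xx.
rewrite rleBrDr -rleBlDr; apply: le_trans (_ : rmeet x c <= _); last by apply: hb; exists x.
by rewrite e rleD2l rleN2; apply: rjoin_mono => //; apply: (sups_ub h).
Qed.

Lemma sups_add X Y a b : supremums X a -> supremums Y b ->
  supremums [set x + y | x in X & y in Y] (a + b).
Proof.
move=> ha hb; apply: mk_sups => [_ [x Xx [y Yy <-]]|c hc].
  by apply: rleD; [apply: (sups_ub ha)|apply: (sups_ub hb)].
rewrite -rleBrDr; apply: (sups_le ha) => x Xx.
rewrite rleBrDr addrC -rleBrDr; apply: (sups_le hb) => y Yy.
by rewrite rleBrDr addrC; apply: hc; exists x => //; exists y.
Qed.

Lemma sups_eq_ub X Y a : (forall b, (forall x, X x -> x <= b) <-> (forall y, Y y -> y <= b)) ->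
  supremums X a -> supremums Y a.
Proof.
move=> h hX; apply: mk_sups => [|b /h hb]; last exact: sups_le hX hb.
by apply/h => x Xx; apply: (sups_ub hX).
Qed.

Lemma sup_meet0 X a c : supremums X a -> X !=set0 ->
  (forall x, X x -> rmeet x c = 0) -> rmeet a c = 0.
Proof.
move=> ha [x0 X0] h; apply: (sups_uniq (sups_meet c ha)).
apply: mk_sups => [_ [x Xx <-]|b hb]; first by rewrite h.
by rewrite -(h _ X0); apply: hb; exists x0.
Qed.

Section Dedekind.
Hypothesis dedE : dedekind_complete [set: E].

Lemma ded_sup X b : X !=set0 -> (forall x, X x -> x <= b) -> exists s, supremums X s.
Proof.
move=> X0 hb; have [|s [_ h1 h2]] := dedE (fun x _ => I : [set: E] x) X0.
  by exists b => // x /hb.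
by exists s; split => // t ht; apply: h2.
Qed.

Lemma archimedean x y : (forall n, n%:R *: x <= y) -> x <= 0.
Proof.
move=> h; have [||s hs] := @ded_sup (range (fun n => n%:R *: x)) y.
- by exists (0%:R *: x); exists 0.
- by move=> _ [n _ <-].
have : s <= s - x.
  apply: (sups_le hs) => _ [n _ <-]; rewrite rleBrDr.
  have := sups_ub hs (imageT (fun n => n%:R *: x) n.+1).
  by rewrite -natr1 scalerDl scale1r.
by rewrite rleBrDr -{2}(addr0 s) rleD2l.
Qed.

End Dedekind.
End RieszOrder.

(** * Dedekind complete f-algebras *)

(** A synonym of the carrier, on which the multiplication becomes a commutative
   ring structure next to the Riesz space structure; identities in the f-algebra
   are then ring identities. *)
Definition falg (R : numDomainType) (U : rieszType R) (mul : U -> U -> U)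
  (one : U) (h : f_algebra mul one) : Type := U.

Section FalgRing.
Variables (R : numDomainType) (U : rieszType R) (mul : U -> U -> U) (one : U).
Variable h : f_algebra mul one.
HB.instance Definition _ := RieszSpace.on (falg h).
HB.instance Definition _ := GRing.Zmodule_isComPzRing.Build (falg h)
  (falg_mulA h) (falg_mulC h) (falg_mul1 h) (falg_mulDl h).
End FalgRing.

Section Falg.
Variables (R : realType) (U : rieszType R) (mul : U -> U -> U) (one : U).
Variable h : f_algebra mul one.
Local Notation A := (falg h).
Implicit Types (x y z a b c p q u v w : A) (X Y : set A).

Lemma fmul_ge0 x y : 0 <= x -> 0 <= y -> 0 <= x * y.
Proof. exact: (falg_mul_ge0 h). Qed.

Lemma fscaleAl (k : R) x y : k *: (x * y) = (k *: x) * y.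
Proof. exact/esym/(falg_mulZl h). Qed.

(** Real scalars as elements of the algebra, so that they take part in ring
   identities. *)
Definition fconst (k : R) : A := k *: (1 : A).
Local Notation sc := fconst.

Lemma fscaleE (k : R) x : k *: x = sc k * x.
Proof. by rewrite /fconst -fscaleAl mul1r. Qed.

Lemma fle_mull a x y : 0 <= a -> x <= y -> a * x <= a * y.
Proof. by move=> a0 xy; rewrite -rsub_ge0 -mulrBr fmul_ge0// rsub_ge0. Qed.

Lemma fle_mulr a x y : 0 <= a -> x <= y -> x * a <= y * a.
Proof. by move=> a0 xy; rewrite ![_ * a]mulrC fle_mull. Qed.

(** The disjointness axiom multiplies one factor at a time; using it for both
   factors makes x y disjoint from itself. *)
Lemma meet_mul0 x y : rmeet x y = 0 -> x * y = 0.
Proof.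
move=> xy0.
have x0 : 0 <= x by rewrite -xy0 rmeet_lel.
have y0 : 0 <= y by rewrite -xy0 rmeet_ler.
have h1 : rmeet (y * x) y = 0 by exact: (falg_mul_disj h).
have h2 : rmeet (x * y) (y * x) = 0 by apply: (falg_mul_disj h) => //; rewrite rmeetC.
by rewrite mulrC rmeet_l// in h2; rewrite mulrC.
Qed.

Lemma fposneg0 x : rpos x * rneg x = 0.
Proof. exact/meet_mul0/rpos_meet_neg. Qed.

Lemma fsqr_ge0 x : 0 <= x * x.
Proof.
rewrite -(rposBneg x); set p := rpos x; set n := rneg x.
have pn0 : p * n = 0 by exact: fposneg0.
have -> : (p - n) * (p - n) = p * p + n * n - (p * n + p * n) by ring.
by rewrite pn0 !addr0 subr0 raddr_ge0// fmul_ge0// ?rpos_ge0// rneg_ge0.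
Qed.

Lemma fone_ge0 : 0 <= 1 :> A.
Proof. by rewrite -(mulr1 1) fsqr_ge0. Qed.

Lemma fconst_ge0 (k : R) : 0 <= k -> 0 <= sc k.
Proof. by move=> k0; rewrite rscale_ge0// fone_ge0. Qed.

Lemma fconst_le (k l : R) : k <= l -> sc k <= sc l.
Proof. by move=> kl; apply: rscale_le2 => //; apply: fone_ge0. Qed.

Lemma fconstM (k l : R) : sc (k * l) = sc k * sc l.
Proof. by rewrite -fscaleE /fconst scalerA. Qed.

Lemma fconstD (k l : R) : sc (k + l) = sc k + sc l.
Proof. exact: scalerDl. Qed.

Lemma fconstN (k : R) : sc (- k) = - sc k.
Proof. exact: scaleNr. Qed.

Lemma fconst0 : sc 0 = 0. Proof. exact: scale0r. Qed.
Lemma fconst1 : sc 1 = 1. Proof. exact: scale1r. Qed.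
Lemma fconst2 : sc 2 = 2. Proof. exact: scaler_nat. Qed.

Lemma fconstZ (k l : R) : k *: sc l = sc (k * l).
Proof. exact: scalerA. Qed.

Hypothesis dedA : dedekind_complete [set: A].

(** (n x - 1)^2 >= 0 gives 2 n x <= 1 for all n. *)
Lemma fsqr_eq0 x : x * x = 0 -> 0 <= x -> x = 0.
Proof.
move=> xx x0; apply/le_anti; rewrite x0 andbT.
rewrite -(@rscale_le _ _ 2)// scaler0; apply: (archimedean dedA (y := 1)) => n.
rewrite -rsub_ge0 fscaleE [2 *: _]fscaleE.
set c := sc n%:R.
rewrite fconst2.
have <- : (c * x - 1) * (c * x - 1) = 1 - c * (2 * x).
  transitivity (c * c * (x * x) + 1 - c * (2 * x)); first by ring.
  by rewrite xx mulr0 add0r.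
exact: fsqr_ge0.
Qed.

Lemma mul_meet0 x y : 0 <= x -> 0 <= y -> x * y = 0 -> rmeet x y = 0.
Proof.
move=> x0 y0 xy; apply: fsqr_eq0; last exact: rmeet_ge0.
apply/le_anti; rewrite fsqr_ge0 andbT -xy.
apply: le_trans (fle_mull _ (rmeet_ler x y)) _; first exact: rmeet_ge0.
by apply: fle_mulr => //; apply: rmeet_lel.
Qed.

Lemma fone_weak_unit x : 0 <= x -> rmeet x 1 = 0 -> x = 0.
Proof. by move=> x0 /meet_mul0; rewrite mulr1. Qed.

(** For a <= c the difference a (s - x) is at most c (s - x), so continuity of
   the multiplication reduces to continuity of a scaling. *)
Lemma sups_mul X s a (c : R) : 0 < c -> 0 <= a -> a <= sc c ->
  supremums X s -> supremums [set a * x | x in X] (a * s).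
Proof.
move=> c0 a0 ac hX; apply: mk_sups => [_ [x Xx <-]|t ht].
  by apply: fle_mull => //; apply: (sups_ub hX).
suff : c *: s <= c *: s - a * s + t.
  by rewrite -addrA -{1}(addr0 (c *: s)) rleD2l addrC rsub_ge0.
apply: (sups_le (sups_scale c0 hX)) => _ [x Xx <-].
have hx : 0 <= s - x by rewrite rsub_ge0 (sups_ub hX).
have : a * (s - x) <= sc c * (s - x) by apply: fle_mulr.
rewrite -fscaleE => hle.
rewrite -rsub_ge0.
have -> : c *: s - a * s + t - c *: x = (c *: (s - x) - a * (s - x)) + (t - a * x).
  by rewrite scalerBr; ring.
by apply: raddr_ge0; rewrite rsub_ge0//; apply: ht; exists x.
Qed.

(** * Idempotents and indicators *)

Definition idem p := p * p = p.

Lemma idem_ge0 p : idem p -> 0 <= p.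
Proof. by move=> <-; apply: fsqr_ge0. Qed.

Lemma idemC p : idem p -> idem (1 - p).
Proof. by rewrite /idem => hp; rewrite mulrBr mulr1 mulrBl mul1r hp subrr subr0. Qed.

Lemma idem_le1 p : idem p -> p <= 1.
Proof. by move=> /idemC/idem_ge0; rewrite rsub_ge0. Qed.

Lemma idem_compl0 p : idem p -> p * (1 - p) = 0.
Proof. by move=> hp; rewrite mulrBr mulr1 hp subrr. Qed.

Lemma idem1 : idem 1. Proof. exact: mulr1. Qed.

Lemma idemM p q : idem p -> idem q -> idem (p * q).
Proof. by move=> hp hq; rewrite /idem mulrACA hp hq. Qed.

Lemma idem_mul_le p x : idem p -> 0 <= x -> p * x <= x.
Proof. by move=> /idem_le1 h1 x0; rewrite -{2}[x]mul1r fle_mulr. Qed.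

Lemma idem_absorb p x : idem p -> 0 <= x -> x <= p -> x * (1 - p) = 0.
Proof.
move=> hp x0 xp; apply/le_anti/andP; split; last first.
  by rewrite fmul_ge0// rsub_ge0 idem_le1.
rewrite -(idem_compl0 hp); apply: fle_mulr => //.
by rewrite rsub_ge0 idem_le1.
Qed.

(** The supremum of this set is the indicator of the part of the space where u
   is positive. *)
Definition chi_seq u : set A := range (fun n => rmeet (1 : A) (n%:R *: rpos u)).

Lemma chi_seq_neq0 u : chi_seq u !=set0.
Proof. by exists (rmeet (1 : A) (0%:R *: rpos u)); exists 0. Qed.

Lemma chi_exists u : exists p, [/\ supremums (chi_seq u) p, idem p & p * u = rpos u].
Proof.
set v := rpos u; have v0 : 0 <= v by apply: rpos_ge0.
have o0 := fone_ge0.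
pose s n := rmeet (1 : A) (n%:R *: v).
have s0 n : 0 <= s n by apply: rmeet_ge0 => //; apply: rscale_ge0.
have [p hp] : exists p, supremums (chi_seq u) p.
  by apply: (ded_sup dedA (chi_seq_neq0 u) (b := 1)) => _ [n _ <-]; apply: rmeet_lel.
have sp n : s n <= p by apply: (sups_ub hp); exists n.
have p0 : 0 <= p := le_trans (s0 0%N) (sp 0%N).
have p1 : p <= 1 by apply: (sups_le hp) => _ [n _ <-]; apply: rmeet_lel.
have pp : p * p = p.
  (* 1 /\ 2 s_n <= s_{2n}, hence 1 /\ 2p = p: p and its complement are disjoint *)
  have h2 : rmeet (2 *: p) 1 <= p.
    have hm := sups_meet (1 : A) (sups_scale (ltr0Sn R 1) hp).
    apply: (sups_le hm) => _ [_ [_ [n _ <-] <-] <-].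
    apply: le_trans (sp (2 * n)%N); rewrite /s rmeet_ge rmeet_ler /=.
    rewrite natrM -scalerA; apply: le_trans (rmeet_lel _ _) _.
    by rewrite rscale_le ?ltr0n// rmeet_ler.
  have h3 : rmeet p (1 - p) = 0.
    apply/le_anti; rewrite rmeet_ge0// ?rsub_ge0// andbT.
    rewrite -(rleD2r p) add0r rmeetDr subrK.
    by rewrite -mulr2n -scaler_nat.
  have := meet_mul0 h3; rewrite mulrBr mulr1 => /eqP.
  by rewrite subr_eq0 => /eqP.
have pv : (1 - p) * v = 0.
  rewrite mulrC; apply: meet_mul0.
  set w := rmeet v (1 - p).
  suff wp : p + w <= p.
    by apply/le_anti; rewrite rmeet_ge0// ?rsub_ge0// andbT -(rleD2l p) addr0.
  rewrite -rleBrDr; apply: (sups_le hp) => _ [n _ <-].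
  rewrite rleBrDr; apply: le_trans (sp n.+1); rewrite /s rmeet_ge; apply/andP; split.
    rewrite -[X in _ <= X](subrK p 1) [_ + p]addrC.
    by apply: rleD; [apply: sp | apply: rmeet_ler].
  rewrite -natr1 scalerDl scale1r.
  by apply: rleD; [apply: rmeet_ler | apply: rmeet_lel].
have pn : p * rneg u = 0.
  apply: meet_mul0; apply: (sup_meet0 hp (chi_seq_neq0 u)) => _ [n _ <-].
  apply: (rmeet0_le (s0 n) (rneg_ge0 u) (rmeet_ler _ _) (lexx _)).
  by apply: rmeet0Mn => //; [apply: rneg_ge0 | apply: rpos_meet_neg].
exists p; split=> //.
rewrite -{1}(rposBneg u) mulrBr pn subr0 -/v.
by move: pv; rewrite mulrBl mul1r => /eqP; rewrite subr_eq0 => /eqP.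
Qed.

Definition chi u := xget 0 [set p | [/\ supremums (chi_seq u) p, idem p & p * u = rpos u]].

Lemma chiP u : [/\ supremums (chi_seq u) (chi u), idem (chi u) & chi u * u = rpos u].
Proof. by rewrite /chi; case: xgetP => // hn; have [p /hn] := chi_exists u. Qed.

Lemma chi_sup u : supremums (chi_seq u) (chi u). Proof. by case: (chiP u). Qed.
Lemma chi_idem u : idem (chi u). Proof. by case: (chiP u). Qed.
Lemma chi_mul u : chi u * u = rpos u. Proof. by case: (chiP u). Qed.
Lemma chi_ge0 u : 0 <= chi u. Proof. exact/idem_ge0/chi_idem. Qed.
Lemma chi_le1 u : chi u <= 1. Proof. exact/idem_le1/chi_idem. Qed.

Lemma chi_mul_ge0 u : 0 <= chi u * u. Proof. by rewrite chi_mul rpos_ge0. Qed.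

Lemma chiC_mul u : (1 - chi u) * u = - rneg u.
Proof. by rewrite mulrBl mul1r chi_mul -{1}(rposBneg u) addrAC subrr add0r. Qed.

Lemma chiC_mul_le0 u : (1 - chi u) * u <= 0.
Proof. by rewrite chiC_mul roppr_le0 rneg_ge0. Qed.

Lemma chiC_pos u : (1 - chi u) * rpos u = 0.
Proof. by rewrite -chi_mul mulrA [(1 - _) * _]mulrC idem_compl0 ?mul0r//; exact: chi_idem. Qed.

Lemma chi_mono u v : u <= v -> chi u <= chi v.
Proof.
move=> uv; apply: (sups_le (chi_sup u)) => _ [n _ <-].
apply: (@le_trans _ _ (rmeet (1 : A) (n%:R *: rpos v))).
  by apply: rmeet_mono => //; apply: riesz_leZ => //; apply: rpos_mono.
by apply: (sups_ub (chi_sup v)); exists n.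
Qed.

Lemma chi_disjoint u w : 0 <= w -> w * rpos u = 0 -> w * chi u = 0.
Proof.
move=> w0 wu; rewrite mulrC; apply: meet_mul0.
apply: (sup_meet0 (chi_sup u) (chi_seq_neq0 u)) => _ [n _ <-].
apply: (rmeet0_le _ w0 (rmeet_ler _ _) (lexx _)) => //.
  by apply: rmeet_ge0; [apply: fone_ge0 | apply: rscale_ge0 => //; apply: rpos_ge0].
apply: rmeet0Mn => //; first exact: rpos_ge0.
by apply: mul_meet0 => //; [apply: rpos_ge0 | rewrite mulrC].
Qed.

Lemma chi_le p u : idem p -> (1 - p) * rpos u = 0 -> chi u <= p.
Proof.
move=> hp /(chi_disjoint (idem_ge0 (idemC hp))).
rewrite mulrBl mul1r => /eqP; rewrite subr_eq0 => /eqP->.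
rewrite -{2}[p]mulr1; apply: fle_mull; [exact: idem_ge0 | exact: chi_le1].
Qed.

Lemma idem_pos0 p u : 0 <= p -> p * u <= 0 -> p * rpos u = 0.
Proof.
move=> p0 pu; apply/le_anti/andP; split; last by rewrite fmul_ge0// rpos_ge0.
rewrite -chi_mul mulrCA -(mulr0 (chi u)); apply: fle_mull => //; exact: chi_ge0.
Qed.

(** The unit is a weak order unit: for the supremum s of the truncations,
   w = (y - s) /\ 1 satisfies s + w <= s. *)
Lemma sups_trunc y : 0 <= y -> supremums (range (fun n => rmeet y (sc n%:R))) y.
Proof.
move=> y0; set X := range _.
have [||s hs] := @ded_sup _ _ dedA X y.
- by exists (rmeet y (sc 0%:R)); exists 0.
- by move=> _ [n _ <-]; apply: rmeet_lel.
have sy : s <= y by apply: (sups_le hs) => _ [n _ <-]; apply: rmeet_lel.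
suff : rmeet (y - s) 1 = 0.
  move=> /(fone_weak_unit _) e; have : y - s = 0 by apply: e; rewrite rsub_ge0.
  by move/eqP; rewrite subr_eq0 => /eqP ->.
set w := rmeet _ _.
apply/le_anti; rewrite rmeet_ge0 ?rsub_ge0 ?fone_ge0// andbT -(rleD2l s) addr0.
rewrite -rleBrDr; apply: (sups_le hs) => _ [n _ <-].
rewrite rleBrDr; apply: (@le_trans _ _ (rmeet y (sc n.+1%:R))); last first.
  by apply: (sups_ub hs); exists n.+1.
rewrite rmeet_ge; apply/andP; split.
  rewrite -[X in _ <= X](subrK s y) [y - s + s]addrC; apply: rleD; last exact: rmeet_lel.
  by apply: (sups_ub hs); exists n.
by rewrite -natr1 fconstD fconst1; apply: rleD; apply: rmeet_ler.
Qed.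

End Falg.

(** * Bounded elements and their squares *)

Section FalgScalars.
Variables (R : realType) (U : rieszType R) (mul : U -> U -> U) (one : U).
Variable h : f_algebra mul one.
Local Notation A := (falg h).
Local Notation sc := (fconst h).
Implicit Types (x y z a b c p q u v w : A) (X Y : set A).

Lemma fabsM x y : rabs (x * y) <= rabs x * rabs y.
Proof.
rewrite rabs_le !rabs_posneg.
have -> : x * y = (rpos x - rneg x) * (rpos y - rneg y) by rewrite !rposBneg.
have := (rpos_ge0 x, rneg_ge0 x, rpos_ge0 y, rneg_ge0 y).
move: (rpos x) (rneg x) (rpos y) (rneg y) => a b c d [[[a0 b0] c0] d0].
apply/andP; split; rewrite -rsub_ge0.
  have -> : (a + b) * (c + d) - (a - b) * (c - d) = (a * d + b * c) + (a * d + b * c) by ring.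
  by rewrite !raddr_ge0// fmul_ge0.
have -> : (a + b) * (c + d) - - ((a - b) * (c - d)) = (a * c + b * d) + (a * c + b * d) by ring.
by rewrite !raddr_ge0// fmul_ge0.
Qed.

Definition bnd y := exists2 c : R, 0 < c & rabs y <= sc c.

Lemma bnd_fconst (k : R) : bnd (sc k).
Proof.
exists (`|k| + 1); first by rewrite ltr_wpDl.
rewrite rabs_le; apply/andP; split; rewrite -?fconstN; apply: fconst_le.
  by rewrite (le_trans (ler_norm _))// lerDl.
by rewrite (le_trans (ler_norm _))// normrN lerDl.
Qed.

Lemma bndD x y : bnd x -> bnd y -> bnd (x + y).
Proof.
move=> [c c0 xc] [d d0 yd]; exists (c + d); first exact: addr_gt0.
by rewrite fconstD; apply: le_trans (rabsD _ _) _; apply: rleD.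
Qed.

Lemma bndM x y : bnd x -> bnd y -> bnd (x * y).
Proof.
move=> [c c0 xc] [d d0 yd]; exists (c * d); first exact: mulr_gt0.
rewrite fconstM; apply: le_trans (fabsM _ _) _.
apply: (@le_trans _ _ (rabs x * sc d)).
  by apply: fle_mull => //; apply: rabs_ge0.
by apply: fle_mulr => //; apply/fconst_ge0/ltW.
Qed.

Lemma bnd_le (c : R) y : 0 <= y -> 0 < c -> y <= sc c -> bnd y.
Proof. by move=> y0 c0 yc; exists c => //; rewrite rabs_id. Qed.

Hypothesis dedA : dedekind_complete [set: A].

(** Bisection: the values of y on the part p of the space lie within r of t;
   splitting p by the sign of y - t and moving t by r/2 halves r. *)
Lemma bisect y w : (forall t : R, w <= (y - sc t) * (y - sc t)) ->
  forall n p (t r : R), idem p -> p * (y - sc t) <= sc r * p ->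
    - (p * (y - sc t)) <= sc r * p -> p * w <= sc ((r / 2 ^+ n) * (r / 2 ^+ n)) * p.
Proof.
move=> hw; elim=> [|n IH] p t r hp h1 h2.
  rewrite expr0 divr1; apply: (@le_trans _ _ (p * ((y - sc t) * (y - sc t)))).
    by apply: fle_mull => //; apply: idem_ge0.
  rewrite fconstM -rsub_ge0.
  have -> : sc r * sc r * p - p * ((y - sc t) * (y - sc t)) =
     (sc r * p - p * (y - sc t)) * (sc r * p + p * (y - sc t)).
    transitivity (sc r * sc r * (p * p) - p * p * ((y - sc t) * (y - sc t))); last by ring.
    by rewrite hp.
  by apply: fmul_ge0; rewrite ?rsub_ge0// -[_ * (y - _) in X in _ <= X]opprK rsub_ge0.
set q := chi (y - sc t).
have hq : idem q by apply: chi_idem.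
have hpq : idem (p * q) by apply: idemM.
have hpq' : idem (p * (1 - q)) by apply: idemM => //; apply: idemC.
have e2 : r / 2 ^+ n.+1 = r / 2 / 2 ^+ n by rewrite exprS invfM mulrA.
have e : sc (r / 2) + sc (r / 2) = sc r by rewrite -fconstD -splitr.
have q0 : 0 <= q := idem_ge0 hq.
have q1 : 0 <= 1 - q := idem_ge0 (idemC hq).
have p0 : 0 <= p := idem_ge0 hp.
have s1 : 0 <= q * (y - sc t) by apply: chi_mul_ge0.
have s2 : (1 - q) * (y - sc t) <= 0 by apply: chiC_mul_le0.
rewrite e2; have -> : p * w = p * q * w + p * (1 - q) * w by ring.
set K := sc _ in IH *.
have -> : K * p = K * (p * q) + K * (p * (1 - q)) by ring.
apply: rleD.
  apply: (IH _ (t + r / 2)) => //; rewrite -rsub_ge0 fconstD.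
    have -> : sc (r / 2) * (p * q) - p * q * (y - (sc t + sc (r / 2))) =
      q * ((sc (r / 2) + sc (r / 2)) * p - p * (y - sc t)) by ring.
    by rewrite e fmul_ge0// rsub_ge0.
  have -> : sc (r / 2) * (p * q) - - (p * q * (y - (sc t + sc (r / 2)))) =
      p * (q * (y - sc t)) by ring.
  exact: fmul_ge0.
apply: (IH _ (t - r / 2)) => //; rewrite -rsub_ge0 fconstD fconstN.
  have -> : sc (r / 2) * (p * (1 - q)) - p * (1 - q) * (y - (sc t - sc (r / 2))) =
      p * - ((1 - q) * (y - sc t)) by ring.
  by rewrite fmul_ge0// roppr_ge0.
have -> : sc (r / 2) * (p * (1 - q)) - - (p * (1 - q) * (y - (sc t - sc (r / 2)))) =
      (1 - q) * ((sc (r / 2) + sc (r / 2)) * p - - (p * (y - sc t))) by ring.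
by rewrite e fmul_ge0// rsub_ge0.
Qed.

(** In other words, the infimum over real t of (y - t)^2 vanishes. It allows a
   square to be bounded through linear expressions only, on which a positive
   linear map can act. *)
Lemma sqr_dist_inf y w : bnd y -> (forall t : R, w <= (y - sc t) * (y - sc t)) -> w <= 0.
Proof.
move=> [c c0 yc] hw; apply: (archimedean dedA (y := sc (c * c))) => n.
have : 1 * w <= sc ((c / 2 ^+ n) * (c / 2 ^+ n)) * 1.
  apply: (@bisect _ _ hw n 1 0 c); rewrite ?fconst0 ?subr0 ?mul1r ?mulr1; first exact: idem1.
    by apply: le_trans yc; apply: rle_abs.
  by apply: le_trans yc; apply: rleN_abs.
rewrite mul1r mulr1 => hle.
apply: (@le_trans _ _ (n%:R *: sc ((c / 2 ^+ n) * (c / 2 ^+ n)))).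
  exact: riesz_leZ.
rewrite fconstZ; apply: fconst_le.
rewrite mulrACA -invfM -exprD mulrCA ler_piMr//; first by rewrite mulr_ge0// ltW.
apply: ltW; rewrite ltr_pdivrMr ?exprn_gt0// mul1r -natrX ltr_nat.
by rewrite (leq_ltn_trans (leq_addr n n))// ltn_expl.
Qed.

End FalgScalars.

(** * Conditional expectations on an order dense ideal *)

Definition dirset d (E : porderType d) (X : set E) :=
  forall x y, X x -> X y -> exists z, [/\ X z, (x <= z)%O & (y <= z)%O].

Lemma dirset_image d d' (E : porderType d) (F : porderType d') (f : E -> F) (X : set E) :
  (forall x y, X x -> X y -> (x <= y)%O -> (f x <= f y)%O) ->
  dirset X -> dirset (f @` X).
Proof.
move=> hf hX _ _ [x Xx <-] [y Yy <-]; have [z [Xz xz yz]] := hX _ _ Xx Yy.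
by exists (f z); split; [exists z | apply: hf | apply: hf].
Qed.

Section Cexp.
Variables (R : realType) (U : rieszType R) (mul : U -> U -> U) (one : U).
Variable h : f_algebra mul one.
Local Notation A := (falg h).
Local Notation sc := (fconst h).
Implicit Types (x y z a b c p q u v w : A) (X Y : set A).
Hypothesis dedA : dedekind_complete [set: A].

(** The copy of the base space inside its universal completion. *)
Record dense_ideal (L : set A) : Prop := {
  di_lin : linear_subspace L;
  di_solid : forall x y, L y -> 0 <= x -> x <= y -> L x;
  di_dense : forall u, 0 < u -> exists2 x, L x & 0 < x /\ x <= u;
  di_join : forall x y, L x -> L y -> L (rjoin x y);
  di_one : L 1
}.

(** Conditional expectations as partial maps defined on L; order continuity is
   stated along increasing nets. *)
Record cexp (L : set A) (tau : A -> A) : Prop := {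
  cx_in : forall x, L x -> L (tau x);
  cx_add : forall x y, L x -> L y -> tau (x + y) = tau x + tau y;
  cx_scale : forall (k : R) x, L x -> tau (k *: x) = k *: tau x;
  cx_pos : forall x, L x -> 0 < x -> 0 < tau x;
  cx_sup : forall X x, X `<=` L -> X !=set0 -> dirset X -> supremums X x -> L x ->
    supremums (tau @` X) (tau x);
  cx_idem : forall x, L x -> tau (tau x) = tau x;
  cx_one : tau 1 = 1
}.

Variable L : set A.
Hypothesis dL : dense_ideal L.

Lemma ideal0 : L 0. Proof. by case: (di_lin dL). Qed.
Lemma idealD x y : L x -> L y -> L (x + y). Proof. by case: (di_lin dL) => _ + _; apply. Qed.
Lemma idealZ (k : R) x : L x -> L (k *: x). Proof. by case: (di_lin dL) => _ _; apply. Qed.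
Lemma idealN x : L x -> L (- x). Proof. by rewrite -scaleN1r; apply: idealZ. Qed.
Lemma idealB x y : L x -> L y -> L (x - y). Proof. by move=> lx ly; apply: idealD => //;
  apply: idealN. Qed.
Lemma ideal_fconst (k : R) : L (sc k). Proof. exact/idealZ/(di_one dL). Qed.

Lemma ideal_abs x : L (rabs x) -> L x.
Proof.
move=> lx; rewrite -(rposBneg x); apply: idealB; apply: di_solid lx _ _ => //;
  rewrite ?rpos_ge0 ?rneg_ge0// rabs_posneg.
  by apply: rle_addr; apply: rneg_ge0.
by apply: rle_addl; apply: rpos_ge0.
Qed.

Lemma ideal_bnd y : bnd y -> L y.
Proof. by move=> [c _ hc]; apply/ideal_abs/(di_solid dL (ideal_fconst c)) => //;
  apply: rabs_ge0. Qed.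

Lemma ideal_mul (c : R) x y : 0 <= x -> x <= sc c -> L y -> 0 <= y -> L (x * y).
Proof.
move=> x0 xc ly y0; apply: (di_solid dL (idealZ c ly)); first exact: fmul_ge0.
by rewrite [c *: y]fscaleE fle_mulr.
Qed.

Section One.
Variable tau : A -> A.
Hypothesis ht : cexp L tau.

Lemma cx0 : tau 0 = 0.
Proof. by rewrite -(scale0r (0 : A)) (cx_scale ht) ?scale0r//; exact: ideal0. Qed.

Lemma cxN x : L x -> tau (- x) = - tau x.
Proof. by move=> lx; rewrite -scaleN1r (cx_scale ht)// scaleN1r. Qed.

Lemma cxB x y : L x -> L y -> tau (x - y) = tau x - tau y.
Proof. by move=> lx ly; rewrite (cx_add ht) ?cxN//; exact: idealN. Qed.

Lemma cx_fconst (k : R) : tau (sc k) = sc k.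
Proof. by rewrite /fconst (cx_scale ht) ?(cx_one ht)//; exact: (di_one dL). Qed.

Lemma cx_ge0 x : L x -> 0 <= x -> 0 <= tau x.
Proof.
move=> lx; rewrite le_eqVlt => /orP[/eqP<-|x0]; first by rewrite cx0.
exact/ltW/(cx_pos ht).
Qed.

Lemma cx_mono x y : L x -> L y -> x <= y -> tau x <= tau y.
Proof. by move=> lx ly xy; rewrite -rsub_ge0 -cxB// cx_ge0 ?rsub_ge0//; exact: idealB. Qed.

Lemma cx_eq0 x : L x -> 0 <= x -> tau x <= 0 -> x = 0.
Proof.
move=> lx; rewrite le_eqVlt => /orP[/eqP<-//|x0] h0.
by have := lt_le_trans (cx_pos ht lx x0) h0; rewrite ltxx.
Qed.

Lemma cx_bnd y : bnd y -> bnd (tau y).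
Proof.
move=> hy; have ly := ideal_bnd hy; case: hy => c c0; rewrite rabs_le => /andP[h1 h2].
exists c => //; rewrite rabs_le -cxN// -(cx_fconst c).
by rewrite !cx_mono//; try exact: idealN; exact: ideal_fconst.
Qed.

(** The range of a conditional expectation, described by its fixed points. *)
Definition fixp x := L x /\ tau x = x.

Lemma fixp_tau x : L x -> fixp (tau x).
Proof. by move=> lx; split; [apply: (cx_in ht) | apply: (cx_idem ht)]. Qed.

Lemma fixp_fconst (k : R) : fixp (sc k).
Proof. by split; [apply: ideal_fconst | apply: cx_fconst]. Qed.

Lemma fixp0 : fixp 0. Proof. by split; [apply: ideal0 | apply: cx0]. Qed.
Lemma fixp1 : fixp 1. Proof. by split; [apply: di_one dL | apply: (cx_one ht)]. Qed.

Lemma fixpD x y : fixp x -> fixp y -> fixp (x + y).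
Proof. by move=> [lx hx] [ly hy]; split; [apply: idealD | rewrite (cx_add ht)// hx hy]. Qed.

Lemma fixpZ (k : R) x : fixp x -> fixp (k *: x).
Proof. by move=> [lx hx]; split; [apply: idealZ | rewrite (cx_scale ht)// hx]. Qed.

Lemma fixpN x : fixp x -> fixp (- x).
Proof. by rewrite -scaleN1r; apply: fixpZ. Qed.

Lemma fixpB x y : fixp x -> fixp y -> fixp (x - y).
Proof. by move=> fx fy; apply: fixpD => //; apply: fixpN. Qed.

(** A subinvariant element is invariant, by strict positivity. *)
Lemma fixp_sub x : L x -> x <= tau x -> tau x = x.
Proof.
move=> lx hx; apply/eqP; rewrite -subr_eq0; apply/eqP; apply: cx_eq0.
- by apply: idealB => //; apply: (cx_in ht).
- by rewrite rsub_ge0.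
- by rewrite cxB ?(cx_idem ht)// ?subrr//; apply: (cx_in ht).
Qed.

Lemma fixp_join x y : fixp x -> fixp y -> fixp (rjoin x y).
Proof.
move=> [lx hx] [ly hy]; have lj : L (rjoin x y) by apply: (di_join dL).
split=> //; apply: fixp_sub => //; rewrite rjoin_le -{1}hx -{2}hy.
by rewrite !cx_mono ?rle_joinl ?rle_joinr.
Qed.

Lemma fixp_meet x y : fixp x -> fixp y -> fixp (rmeet x y).
Proof.
move=> fx fy; rewrite -[rmeet x y](addKr (rjoin x y)) addrC rjoin_meet.
by apply: fixpB; [apply: fixpD | apply: fixp_join].
Qed.

Lemma fixp_sups X x : (forall y, X y -> fixp y) -> X !=set0 -> dirset X -> supremums X x ->
  L x -> fixp x.
Proof.
move=> hX X0 dX sX lx; split=> //.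
suff e : X = tau @` X.
  by apply: (sups_uniq _ sX); rewrite {1}e; apply: (cx_sup ht) => // y /hX[].
apply/seteqP; split=> [y Xy|_ [y Xy <-]]; last by case: (hX _ Xy) => _ ->.
by exists y => //; case: (hX _ Xy).
Qed.

(** Jensen's inequality: apply tau to (y - t)^2 >= 0 and optimize over t. *)
Lemma cx_sqr y : bnd y -> tau y * tau y <= tau (y * y).
Proof.
move=> hy; rewrite -rsub_le0; apply: (sqr_dist_inf dedA (cx_bnd hy)) => t.
have ly := ideal_bnd hy; have lyy := ideal_bnd (bndM hy hy).
have : 0 <= tau ((y - sc t) * (y - sc t)).
  apply: cx_ge0; last exact: fsqr_ge0.
  have hb : bnd (y - sc t) by apply: bndD => //; rewrite -fconstN; apply: bnd_fconst.
  exact: ideal_bnd (bndM hb hb).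
have -> : (y - sc t) * (y - sc t) = y * y - (2 * t) *: y + sc (t * t).
  by rewrite [(2 * t) *: y]fscaleE !fconstM fconst2; ring.
have l2 := idealZ (2 * t) ly.
rewrite (cx_add ht) ?cxB ?cx_fconst ?(cx_scale ht)//; try exact: idealB; try exact: ideal_fconst.
rewrite -[in X in _ -> X]rsub_ge0; congr (is_true (0 <= _)).
by rewrite [(2 * t) *: _]fscaleE !fconstM fconst2; ring.
Qed.

(** Jensen's inequality makes the square subinvariant. *)
Lemma fixp_sqr x : fixp x -> bnd x -> tau (x * x) = x * x.
Proof.
move=> [lx hx] bx; apply: fixp_sub; first exact: ideal_bnd (bndM bx bx).
by rewrite -{1 2}hx; apply: cx_sqr.
Qed.

(** Expanding Jensen's inequality at y + s p, where it is an equality for the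
   fixed point p, leaves an expression affine in s that is nonnegative for all
   s; its slope must vanish. *)
Lemma cx_avg_bnd p y : fixp p -> bnd p -> bnd y -> tau (p * y) = p * tau y.
Proof.
move=> fp bp bY; have [lp hp] := fp; have ly := ideal_bnd bY.
have lpy := ideal_bnd (bndM bp bY); have lyy := ideal_bnd (bndM bY bY);
  have lpp := ideal_bnd (bndM bp bp).
have tpp := fixp_sqr fp bp.
pose V := tau (y * y) - tau y * tau y; pose d := tau (p * y) - p * tau y.
have key (s : R) : 0 <= V + (2 * s) *: d.
  have bs : bnd (y + s *: p).
    by apply: bndD => //; rewrite fscaleE; apply: bndM => //; apply: bnd_fconst.
  have := cx_sqr bs; rewrite -rsub_ge0; congr (is_true (0 <= _)).
  have -> : (y + s *: p) * (y + s *: p) = y * y + (2 * s) *: (p * y) + (s * s) *: (p * p).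
    by rewrite [s *: p]fscaleE [(2 * s) *: _]fscaleE [(s * s) *: _]fscaleE !fconstM fconst2; ring.
  have l1 := idealZ (2 * s) lpy; have l2 := idealZ (s * s) lpp; have l3 := idealZ s lp.
  rewrite !(cx_add ht) ?(cx_scale ht)//; last exact: idealD.
  rewrite tpp hp /V /d [s *: p]fscaleE [(2 * s) *: _]fscaleE [(s * s) *: _]fscaleE.
  by rewrite [(2 * s) *: (_ - _)]fscaleE !fconstM fconst2; ring.
have e2 (n : nat) : 2 * (n%:R / 2) = n%:R :> R by rewrite mulrCA mulfV ?mulr1 ?pnatr_eq0.
have h1 : - d <= 0.
  apply: (archimedean dedA (y := V)) => n; have := key (n%:R / 2).
  by rewrite e2 scalerN -[in X in _ -> X]rsub_ge0 opprK.
have h2 : d <= 0.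
  apply: (archimedean dedA (y := V)) => n; have := key (- (n%:R / 2)).
  by rewrite mulrN e2 scaleNr rsub_ge0.
apply/eqP; rewrite -subr_eq0 -/d; apply/eqP/le_anti.
by rewrite h2 -roppr_le0.
Qed.

(** The averaging property, extended from bounded y by truncation. *)
Lemma cx_avg (c : R) p y : fixp p -> 0 < c -> 0 <= p -> p <= sc c -> L y -> 0 <= y ->
  tau (p * y) = p * tau y.
Proof.
move=> fp c0 p0 pc ly y0; have bp := bnd_le p0 c0 pc.
pose tr n := rmeet y (sc n%:R).
have tr0 n : 0 <= tr n by apply: rmeet_ge0 => //; apply: fconst_ge0.
have trb n : bnd (tr n).
  apply: (@bnd_le _ _ _ _ _ n.+1%:R) => //.
  apply: le_trans (rmeet_ler _ _) _; apply: fconst_le.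
  by rewrite ler_nat.
have trL n := ideal_bnd (trb n).
have hX : supremums (range tr) y := sups_trunc dedA y0.
have X0 : range tr !=set0 by exists (tr 0%N); exists 0%N.
have dX : dirset (range tr).
  move=> _ _ [m _ <-] [n _ <-]; exists (tr (maxn m n)); split; first by exists (maxn m n).
    apply: rmeet_mono => //; apply: fconst_le; rewrite ler_nat; exact: leq_maxl.
  apply: rmeet_mono => //; apply: fconst_le; rewrite ler_nat; exact: leq_maxr.
have h1 := sups_mul c0 p0 pc hX.
have lpy : L (p * y) by apply: (ideal_mul p0 pc).
have h2 : supremums (tau @` [set p * x | x in range tr]) (tau (p * y)).
  apply: (cx_sup ht) => //.
  - by move=> _ [_ [n _ <-] <-]; apply: (ideal_mul p0 pc).
  - by have [x hx] := X0; exists (p * x); exists x.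
  - by apply: dirset_image => // x z _ _; apply: fle_mull.
have h3 : supremums (tau @` range tr) (tau y).
  by apply: (cx_sup ht) => // _ [n _ <-].
have h4 := sups_mul c0 p0 pc h3.
apply: (sups_uniq h2).
suff -> : tau @` [set p * x | x in range tr] = [set p * x | x in tau @` range tr] by [].
rewrite !image_comp; apply: eq_imagel => n _ /=; exact: cx_avg_bnd.
Qed.

End One.

(** * Extension of conditional expectations beyond the ideal *)

Definition below_in a : set A := [set x | [/\ L x, 0 <= x & x <= a]].

(** The value v of the extension of tau at a positive a, when it is finite. *)
Definition expect tau a v := supremums (tau @` below_in a) v.

Lemma below_neq0 a : 0 <= a -> below_in a !=set0.
Proof. by move=> a0; exists 0; split => //; apply: ideal0. Qed.

Lemma below_dir a : dirset (below_in a).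
Proof.
move=> x y [lx x0 xa] [ly y0 ya]; exists (rjoin x y); split; rewrite ?rle_joinl ?rle_joinr//.
split; [exact: (di_join dL) | by apply: le_trans x0 (rle_joinl _ _) | by rewrite rjoin_le xa].
Qed.

Lemma below_sups a : 0 <= a -> supremums (below_in a) a.
Proof.
move=> a0; have [||s hs] := @ded_sup _ _ dedA (below_in a) a.
- exact: below_neq0.
- by move=> x [].
have sa : s <= a by apply: (sups_le hs) => x [].
suff e : a = s by move: hs; rewrite -e.
apply/eqP/negP => /negP ne; have : 0 < a - s by rewrite lt_neqAle rsub_ge0 sa eq_sym subr_eq0 ne.
move=> /(di_dense dL)[x lx [x0 xle]].
have : s <= s - x.
  apply: (sups_le hs) => y [ly y0 ya]; rewrite rleBrDr; apply: (sups_ub hs).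
  split; [exact: idealD | exact: raddr_ge0 (ltW _) |].
  rewrite -[a](subrK s) [_ + s]addrC; apply: rleD => //.
  by apply: (sups_ub hs).
rewrite rleBrDr -{2}(addr0 s) rleD2l => hx.
by have := lt_le_trans x0 hx; rewrite ltxx.
Qed.

Section Expect.
Variable tau : A -> A.
Hypothesis ht : cexp L tau.

(** Order continuity: any directed net increasing to a computes the value of
   the extension at a. *)
Lemma expect_dir X a v : (forall x, X x -> L x /\ 0 <= x) -> X !=set0 -> dirset X ->
  supremums X a -> expect tau a v <-> supremums (tau @` X) v.
Proof.
move=> hX X0 dX sX.
suff hb b : (forall x, (tau @` below_in a) x -> x <= b) <-> (forall x, (tau @` X) x -> x <= b).
  by split; apply: sups_eq_ub => b; rewrite hb.
split=> hb _ [x Xx <-].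
  by apply: hb; exists x => //; have [lx x0] := hX _ Xx; split => //; apply: (sups_ub sX).
case: Xx => lx x0 xa.
have LX y : X y -> L (rmeet y x).
  move=> /hX[ly y0]; apply: (di_solid dL lx); first exact: rmeet_ge0.
  exact: rmeet_ler.
have h1 := sups_meet x sX; rewrite rmeet_r// in h1.
have h2 : supremums (tau @` [set rmeet y x | y in X]) (tau x).
  apply: (cx_sup ht) => //.
  - by move=> _ [y /LX ly <-].
  - by case: X0 => y Xy; exists (rmeet y x); exists y.
  - by apply: dirset_image => // y z _ _ yz; apply: rmeet_mono.
apply: (sups_le h2) => _ [_ [y Xy <-] <-]; apply: le_trans (hb _ _); last by exists y.
apply: (cx_mono ht) => //; [exact: LX | by case: (hX _ Xy) | exact: rmeet_lel].
Qed.

Lemma expect_mono a b v w : a <= b -> expect tau a v -> expect tau b w -> v <= w.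
Proof.
move=> ab hv hw; apply: (sups_le hv) => _ [x [lx x0 xa] <-]; apply: (sups_ub hw).
by exists x => //; split => //; apply: le_trans ab.
Qed.

Lemma expect_uniq a v w : expect tau a v -> expect tau a w -> v = w.
Proof. exact: sups_uniq. Qed.

Lemma expect_L x : L x -> 0 <= x -> expect tau x (tau x).
Proof.
move=> lx x0; apply: mk_sups => [_ [y [ly y0 yx] <-]|b hb]; first exact: (cx_mono ht).
by apply: hb; exists x.
Qed.

Lemma expect_ge0 a v : 0 <= a -> expect tau a v -> 0 <= v.
Proof.
move=> a0 hv; apply: (sups_ub hv); exists 0; last exact: cx0 ht.
by split => //; apply: ideal0.
Qed.

Lemma expectD a b v w : 0 <= a -> 0 <= b -> expect tau a v -> expect tau b w ->
  expect tau (a + b) (v + w).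
Proof.
move=> a0 b0 hv hw.
pose X := [set x + y | x in below_in a & y in below_in b].
apply/(@expect_dir X) => //.
- by move=> _ [x [lx x0 _] [y [ly y0 _] <-]]; split; [apply: idealD | apply: raddr_ge0].
- by have [x hx] := below_neq0 a0; have [y hy] := below_neq0 b0; exists (x + y), x => //;
    exists y.
- move=> _ _ [x hx [y hy <-]] [x' hx' [y' hy' <-]].
  have [x2 [hx2 l1 l2]] := below_dir hx hx'; have [y2 [hy2 l3 l4]] := below_dir hy hy'.
  by exists (x2 + y2); split; [exists x2 => //; exists y2 | apply: rleD | apply: rleD].
- by apply: sups_add; apply: below_sups.
have := sups_add hv hw; congr supremums; apply/seteqP; split.
  move=> _ [_ [x hx <-] [_ [y hy <-] <-]]; exists (x + y); first by exists x => //; exists y.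
  by case: hx hy => lx _ _ [ly _ _]; rewrite (cx_add ht).
move=> _ [_ [x hx [y hy <-]] <-]; exists (tau x); first by exists x.
exists (tau y); first by exists y.
by case: hx hy => lx _ _ [ly _ _]; rewrite (cx_add ht).
Qed.

Lemma expectZ (k : R) a v : 0 < k -> 0 <= a -> expect tau a v -> expect tau (k *: a) (k *: v).
Proof.
move=> k0 a0 hv; pose X := [set k *: x | x in below_in a].
apply/(@expect_dir X) => //.
- by move=> _ [x [lx x0 _] <-]; split; [apply: idealZ | apply: rscale_ge0 => //; apply: ltW].
- by have [x hx] := below_neq0 a0; exists (k *: x), x.
- by apply: dirset_image; [move=> x y _ _; rewrite rscale_le | apply: below_dir].
- by apply: sups_scale => //; apply: below_sups.
have := sups_scale k0 hv; congr supremums; rewrite /X !image_comp;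
  apply: eq_imagel => x [lx _ _] /=.
by rewrite (cx_scale ht).
Qed.

End Expect.
End Cexp.

(** * Finiteness and averaging for the extension *)

Section Finite.
Variables (R : realType) (U : rieszType R) (mul : U -> U -> U) (one : U).
Variable h : f_algebra mul one.
Local Notation A := (falg h).
Local Notation sc := (fconst h).
Implicit Types (x y z a b c p q u v w : A) (X Y : set A).
Hypothesis dedA : dedekind_complete [set: A].
Hypothesis latA : laterally_complete A.
Variable L : set A.
Hypothesis dL : dense_ideal L.

Lemma idem_le_mul p q : idem p -> idem q -> p <= q -> p * q = p.
Proof.
move=> hp hq pq; have := idem_absorb hq (idem_ge0 hp) pq.
by rewrite mulrBr mulr1 => /eqP; rewrite subr_eq0 => /eqP.
Qed.

Lemma sups_idem X p : (forall x, X x -> idem x) -> X !=set0 -> supremums X p -> idem p.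
Proof.
move=> hX [x0 X0] hp.
have xp x : X x -> x <= p by move=> Xx; apply: (sups_ub hp).
have p0 : 0 <= p := le_trans (idem_ge0 (hX _ X0)) (xp _ X0).
have p1 : p <= 1 by apply: (sups_le hp) => x /hX/idem_le1.
have ps1 : p <= sc 1 by rewrite fconst1.
have h1 := sups_mul ltr01 p0 ps1 hp.
apply: (sups_uniq h1); suff -> : [set p * x | x in X] = X by [].
have e x : X x -> p * x = x.
  move=> Xx; have hx := hX _ Xx; apply/le_anti/andP; split.
    rewrite -{2}[x]mul1r; apply: fle_mulr => //; exact: idem_ge0.
  by rewrite -{1}hx; apply: fle_mulr; [exact: idem_ge0 | exact: xp].
apply/seteqP; split=> [_ [x Xx <-]|x Xx]; first by rewrite e.
by exists x => //; apply: e.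
Qed.

(** Increasing idempotents with supremum 1, on each of which X is bounded by
   a multiple of the unit, give a bound for X in a laterally complete algebra:
   glue the bounds along the disjoint differences. *)
Lemma glue_bounds (kap : nat -> A) X : (forall n, idem (kap n)) ->
  (forall n, kap n <= kap n.+1) -> supremums (range kap) 1 ->
  (forall n x, X x -> 0 <= x /\ kap n * x <= kap n * sc n%:R) ->
  exists w, forall x, X x -> x <= w.
Proof.
move=> hk km k1 hX.
have kmn m n : (m <= n)%N -> kap m <= kap n.
  move=> /subnKC<-; elim: (n - m)%N => [|k IH]; rewrite ?addn0// addnS.
  exact: le_trans IH (km _).
have kk m n : (m <= n)%N -> kap m * kap n = kap m by move=> mn; apply: idem_le_mul => //;
  apply: kmn.
pose del n := kap n.+1 - kap n.
have hd n : idem (del n).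
  rewrite /idem /del; have k2 := kk n n.+1 (leqnSn n).
  transitivity (kap n.+1 * kap n.+1 - (kap n * kap n.+1 + kap n * kap n.+1) + kap n * kap n).
    by ring.
  by rewrite !hk k2; ring.
have d0 n : 0 <= del n by apply: idem_ge0.
have dd m n : (m < n)%N -> del m * del n = 0.
  move=> mn.
  transitivity (kap m.+1 * kap n.+1 - kap m.+1 * kap n - kap m * kap n.+1 + kap m * kap n).
    by rewrite /del; ring.
  by rewrite !kk; [ring | exact: ltnW | apply: leqW; exact: ltnW | exact: mn | exact: leqW].
pose g n := del n * sc n.+1%:R.
have g0 n : 0 <= g n by apply: fmul_ge0 => //; apply: fconst_ge0.
have [w hw] : exists w, supremums (range g) w.
  apply: latA; first by exists (g 0%N); exists 0%N.
    by move=> _ [n _ <-].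
  move=> _ _ [m _ <-] [n _ <-] ne; rewrite /rdisjoint !rabs_id//.
  apply: mul_meet0 => //; rewrite /g mulrACA.
  have [mn|nm|e] := ltngtP m n; last by rewrite e in ne.
    by rewrite dd ?mul0r.
  by rewrite [del m * _]mulrC dd ?mul0r.
exists w => x Xx; have [x0 _] := hX 0%N _ Xx.
have hdx n : 0 <= del n * (w - x).
  rewrite mulrBr rsub_ge0; apply: (@le_trans _ _ (g n)).
    have [_ h1] := hX n.+1 _ Xx.
    have -> : del n * x = (1 - kap n) * (kap n.+1 * x).
      by rewrite [RHS]mulrA [(1 - kap n) * _]mulrBl mul1r (kk n n.+1).
    have -> : g n = (1 - kap n) * (kap n.+1 * sc n.+1%:R).
      by rewrite [RHS]mulrA [(1 - kap n) * _]mulrBl mul1r (kk n n.+1).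
    by apply: fle_mull => //; apply/idem_ge0/idemC.
  have -> : g n = del n * g n by rewrite /g mulrA hd.
  by apply: fle_mull => //; apply: (sups_ub hw); exists n.
have w0 : 0 <= w by apply: le_trans (g0 0%N) (sups_ub hw _); exists 0%N.
have hkx n : 0 <= kap n * (w - x).
  elim: n => [|n IH].
    have [_ h1] := hX 0%N _ Xx; rewrite mulrBr rsub_ge0; apply: le_trans h1 _.
    by rewrite fconst0 mulr0 fmul_ge0//; apply: idem_ge0.
  have -> : kap n.+1 * (w - x) = kap n * (w - x) + del n * (w - x) by rewrite /del; ring.
  exact: raddr_ge0.
suff e : rpos (x - w) = 0.
  by rewrite -rsub_le0 -e rle_pos.
apply: (@fone_weak_unit _ _ _ _ h _ (rpos_ge0 _)); rewrite rmeetC.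
apply: (sup_meet0 k1); first by exists (kap 0%N); exists 0%N.
move=> _ [n _ <-]; apply: mul_meet0 => //; [exact: idem_ge0 | exact: rpos_ge0 |].
apply: idem_pos0 => //; first exact: idem_ge0.
by rewrite -[x - w]opprB mulrN roppr_le0.
Qed.

Section OneExp.
Variable tau : A -> A.
Hypothesis ht : cexp L tau.

(** If a directed set were unbounded on some part of the space, its
   expectation would be infinite there by strict positivity. Here rho n is the
   part where X exceeds n; it decreases to 0 because n tau (rho n) <= v. *)
Lemma expect_bounded X v : (forall x, X x -> L x /\ 0 <= x) -> X !=set0 -> dirset X ->
  (forall x, X x -> tau x <= v) -> exists w, forall x, X x -> x <= w.
Proof.
move=> hX X0 dX hv.
pose C n := [set chi (x - sc n%:R) | x in X].
have C0 n : C n !=set0 by have [x Xx] := X0; exists (chi (x - sc n%:R)), x.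
have exrho n : exists r, supremums (C n) r.
  by apply: (ded_sup dedA (C0 n) (b := 1)) => _ [x _ <-]; apply: chi_le1.
pose rho n := sval (cid (exrho n)).
have hr n : supremums (C n) (rho n) := svalP (cid (exrho n)).
have ir n : idem (rho n) by apply: (sups_idem _ (C0 n) (hr n)) => _ [x _ <-]; apply: chi_idem.
have rdec n : rho n.+1 <= rho n.
  apply: (sups_le (hr n.+1)) => _ [x Xx <-]; apply: le_trans (sups_ub (hr n) _); last by exists x.
  by apply: chi_mono => //; rewrite rleD2l rleN2; apply: fconst_le; rewrite ler_nat.
have bnd1 p : 0 <= p -> p <= 1 -> L p by move=> p0 p1; apply: (di_solid dL (di_one dL)).
have Lchi u : L (chi u) by apply: bnd1; [exact: chi_ge0 | exact: chi_le1].
have Lr n : L (rho n) by apply: bnd1; [exact: idem_ge0 | exact: idem_le1].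
have markov n : n%:R *: tau (rho n) <= v.
  case: n => [|n].
    rewrite scale0r; have [x Xx] := X0; apply: le_trans (hv _ Xx).
    by have [lx x0] := hX _ Xx; apply: (cx_ge0 dL ht).
  have hs : supremums (tau @` C n.+1) (tau (rho n.+1)).
    apply: (cx_sup ht) => //; first by move=> _ [x _ <-].
    by apply: dirset_image => // x y _ _ xy; apply: chi_mono => //; rewrite rleD2r.
  apply: (sups_le (sups_scale (ltr0Sn R n) hs)) => _ [_ [_ [x Xx <-] <-] <-].
  apply: le_trans (hv _ Xx); rewrite -(cx_scale ht)//; have [lx x0] := hX _ Xx.
  apply: (cx_mono dL ht) => //; first exact: idealZ.
  set c := chi _; rewrite fscaleE.
  apply: (@le_trans _ _ (c * x)); last by apply: idem_mul_le => //; apply: chi_idem.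
  by rewrite mulrC -rsub_ge0 -mulrBr; apply: chi_mul_ge0.
pose kap n := 1 - rho n.
apply: (@glue_bounds kap).
- by move=> n; apply: idemC.
- by move=> n; rewrite rleD2l rleN2.
- apply: mk_sups => [_ [n _ <-]|b hb]; first exact/idem_le1/idemC.
  suff e : rpos (1 - b) = 0 by rewrite -rsub_le0 -e rle_pos.
  have rb n : rpos (1 - b) <= rho n.
    rewrite /rpos rjoin_le idem_ge0// andbT.
    have : kap n <= b by apply: hb; exists n.
    by rewrite /kap !rleBlDr addrC.
  have lb : L (rpos (1 - b)) by apply: (di_solid dL (Lr 0%N)); rewrite ?rpos_ge0.
  apply: (cx_eq0 ht lb (rpos_ge0 _)).
  apply: (archimedean dedA (y := v)) => n; apply: le_trans (markov n).
  by apply: riesz_leZ => //; apply: (cx_mono dL ht).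
move=> n x Xx; split; first by case: (hX _ Xx).
rewrite -rsub_le0 -mulrBr; set u := x - _.
have cr : chi u <= rho n by apply: (sups_ub (hr n)); exists x.
have -> : kap n * u = - (kap n * rneg u).
  suff e : kap n * rpos u = 0 by rewrite -{1}(rposBneg u) mulrBr e sub0r.
  rewrite -chi_mul// mulrA.
  have -> : kap n * chi u = 0 by rewrite mulrC; apply: idem_absorb => //; apply: chi_ge0.
  by rewrite mul0r.
by rewrite roppr_le0 fmul_ge0 ?rneg_ge0//; apply/idem_ge0/idemC.
Qed.

End OneExp.

Section TwoExp.
(* tau0 is the coarser of the two conditional expectations *)
Variables tau0 tau : A -> A.
Hypothesis ht0 : cexp L tau0.
Hypothesis ht : cexp L tau.
Hypothesis tower : forall x, L x -> tau0 (tau x) = tau0 x.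

Lemma tau_below_dir a : dirset (tau @` below_in L a).
Proof.
apply: dirset_image; last exact: below_dir.
by move=> x y [lx _ _] [ly _ _]; apply: (cx_mono dL ht).
Qed.

Lemma expect_exists F v : 0 <= F -> expect L tau0 F v -> exists a, expect L tau F a.
Proof.
move=> F0 hv; set X := tau @` below_in L F.
have X0 : X !=set0 by have [x hx] := below_neq0 dL F0; exists (tau x), x.
have [||//|x|w hw] := @expect_bounded tau0 ht0 X v.
- by move=> _ [x [lx x0 _] <-]; split; [apply: (cx_in ht) | apply: (cx_ge0 dL ht)].
- exact: X0.
- exact: tau_below_dir.
- by move=> [y hy <-]; have [ly _ _] := hy; rewrite tower//; apply: (sups_ub hv); exists y.
by have [s hs] := ded_sup dedA X0 hw; exists s.
Qed.

(** The products p x and p (tau x), for x in the ideal below F, increase to p F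
   and to p a, and tau0 takes the same values on both families. *)
Lemma expect_avg (c : R) p F a v0 : fixp L tau p -> 0 < c -> 0 <= p -> p <= sc c ->
  0 <= F -> expect L tau F a -> expect L tau0 F v0 ->
  exists v, expect L tau0 (p * F) v /\ expect L tau0 (p * a) v.
Proof.
move=> fp c0 p0 pc F0 ha hv0.
set X := below_in L F; have X0 : X !=set0 := below_neq0 dL F0.
have dX : dirset X := below_dir dL (a := F).
pose Y := [set p * x | x in X].
have Y0 : Y !=set0 by have [x hx] := X0; exists (p * x), x.
have dY : dirset Y by apply: dirset_image => // x y _ _; apply: fle_mull.
have hY x : Y x -> L x /\ 0 <= x.
  by move=> [y [ly y0 _] <-]; split; [apply: (ideal_mul dL p0 pc) | apply: fmul_ge0].
have sY := sups_mul c0 p0 pc (below_sups dedA dL F0).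
pose Z := [set p * x | x in tau @` X].
have Z0 : Z !=set0 by have [x hx] := X0; exists (p * tau x), (tau x) => //; exists x.
have dZ : dirset Z by apply: dirset_image; [move=> x y _ _;
  apply: fle_mull | exact: tau_below_dir].
have hZ x : Z x -> L x /\ 0 <= x.
  move=> [_ [y [ly y0 _] <-] <-].
  have l1 := cx_in ht ly; have l2 := cx_ge0 dL ht ly y0.
  by split; [apply: (ideal_mul dL p0 pc) | apply: fmul_ge0].
have sZ := sups_mul c0 p0 pc ha.
have e : tau0 @` Y = tau0 @` Z.
  rewrite /Y /Z !image_comp; apply: eq_imagel => x [lx x0 _] /=.
  by rewrite -(cx_avg dedA dL ht fp c0) // tower//; apply: (ideal_mul dL p0 pc).
have [v hv] : exists v, supremums (tau0 @` Y) v.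
  apply: (ded_sup dedA (b := c *: v0)).
    by have [y hy] := Y0; exists (tau0 y), y.
  move=> _ [_ [x hx <-] <-]; have [lx x0 _] := hx.
  apply: (@le_trans _ _ (c *: tau0 x)); last by rewrite rscale_le//; apply: (sups_ub hv0);
    exists x.
  rewrite -(cx_scale ht0)//; apply: (cx_mono dL ht0).
  - exact: (ideal_mul dL p0 pc).
  - exact: idealZ.
  - by rewrite fscaleE; apply: fle_mulr.
exists v; split.
  by apply/(expect_dir dL ht0 v hY Y0 dY sY).
by apply/(expect_dir dL ht0 v hZ Z0 dZ sZ); rewrite -e.
Qed.

End TwoExp.
End Finite.

(** * The stopping argument *)

Section Core.
Variables (R : realType) (U : rieszType R) (mul : U -> U -> U) (one : U).
Variable h : f_algebra mul one.
Local Notation A := (falg h).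
Local Notation sc := (fconst h).
Implicit Types (x y z p q v : A) (X Y : set A).
Hypothesis dedA : dedekind_complete [set: A].
Variable L : set A.
Hypothesis dL : dense_ideal L.

Section Measurable.
Variable tau : A -> A.
Hypothesis ht : cexp L tau.

(** Positive elements measurable for tau, possibly outside the ideal. *)
Definition meas x := exists X, [/\ forall y, X y -> fixp L tau y /\ 0 <= y,
  X !=set0, dirset X & supremums X x].

Lemma meas_expect F a : 0 <= F -> expect L tau F a -> meas a.
Proof.
move=> F0 ha; exists (tau @` below_in L F); split=> //.
- move=> _ [y [ly y0 _] <-]; split; first exact: fixp_tau.
  exact: (cx_ge0 dL ht).
- by have [x hx] := below_neq0 dL F0; exists (tau x), x.
- exact: tau_below_dir.
Qed.

(** The indicator is the supremum of a directed family of lattice expressions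
   in fixed points. *)
Lemma meas_chi (l : R) x : meas x -> fixp L tau (chi (x - sc l)).
Proof.
move=> [X [hX X0 dX sX]].
pose T (n : nat) y := rmeet (1 : A) (n%:R *: rpos (y - sc l)).
have Tm m n y z : (m <= n)%N -> y <= z -> T m y <= T n z.
  move=> mn yz; apply: rmeet_mono => //; apply: (@le_trans _ _ (n%:R *: rpos (y - sc l))).
    by apply: rscale_le2; rewrite ?ler_nat ?rpos_ge0.
  by apply: riesz_leZ => //; apply: rpos_mono; rewrite rleD2r.
have fT n y : X y -> fixp L tau (T n y).
  move=> /hX[fy _]; apply: (fixp_meet dL ht); first exact: (fixp1 dL ht).
  apply: (fixpZ dL ht); apply: (fixp_join dL ht); last exact: (fixp0 dL ht).
  by apply: (fixpB dL ht) => //; apply: (fixp_fconst dL ht).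
pose Y := [set T n y | n in [set: nat] & y in X].
have sY : supremums Y (chi (x - sc l)).
  apply: mk_sups => [_ [n _ [y Xy <-]]|b hb].
    apply: (@le_trans _ _ (T n x)); first by apply: Tm => //; apply: (sups_ub sX).
    by apply: (sups_ub (chi_sup dedA _)); exists n.
  apply: (sups_le (chi_sup dedA _)) => _ [n _ <-]; rewrite -/(T n x).
  case: n => [|n].
    have [y Xy] := X0; apply: (@le_trans _ _ (T 0%N y)); first by rewrite /T !scale0r.
    by apply: hb; exists 0%N => //; exists y.
  have X1 : [set y + - sc l | y in X] !=set0 by have [y Xy] := X0; exists (y + - sc l), y.
  have s1 := sups_join 0 X1 (sups_addr (- sc l) sX).
  have s2 := sups_meet (1 : A) (sups_scale (ltr0Sn R n) s1).
  rewrite /T rmeetC; apply: (sups_le s2) => _ [_ [_ [_ [y Xy <-] <-] <-] <-].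
  by rewrite rmeetC; apply: hb; exists n.+1 => //; exists y.
apply: (fixp_sups ht _ _ _ sY).
- by move=> _ [n _ [y Xy <-]]; apply: fT.
- by have [y Xy] := X0; exists (T 0%N y), 0%N => //; exists y.
- move=> _ _ [m _ [y Xy <-]] [n _ [z Xz <-]]; have [t [Xt yt zt]] := dX _ _ Xy Xz.
  exists (T (maxn m n) t); split; first by exists (maxn m n) => //; exists t.
    by apply: Tm => //; apply: leq_maxl.
  by apply: Tm => //; apply: leq_maxr.
- by apply: (di_solid dL (di_one dL)); [apply: chi_ge0 | apply: chi_le1].
Qed.

Lemma fixpM (c : R) p y : fixp L tau p -> 0 < c -> 0 <= p -> p <= sc c ->
  fixp L tau y -> 0 <= y -> fixp L tau (p * y).
Proof.
move=> fp c0 p0 pc [ly hy] y0; split; first exact: (ideal_mul dL p0 pc).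
by rewrite (cx_avg dedA dL ht fp c0)// hy.
Qed.

Lemma meas_mul (c d : R) p x : fixp L tau p -> 0 < c -> 0 <= p -> p <= sc c ->
  meas x -> p * x <= sc d -> fixp L tau (p * x).
Proof.
move=> fp c0 p0 pc [X [hX X0 dX sX]] px.
have [x0 X0'] := X0; have x_ge0 : 0 <= x.
  by apply: le_trans (sups_ub sX X0'); case: (hX _ X0').
apply: (fixp_sups ht _ _ _ (sups_mul c0 p0 pc sX)).
- by move=> _ [y Xy <-]; have [fy y0] := hX _ Xy; apply: (fixpM fp c0).
- by exists (p * x0), x0.
- by apply: dirset_image => // y z _ _; apply: fle_mull.
- by apply: (di_solid dL (ideal_fconst dL d)) => //; apply: fmul_ge0.
Qed.

End Measurable.

Variable tau : nat -> A -> A.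
Hypothesis ht : forall n, cexp L (tau n).
Hypothesis tower : forall m n x, (m <= n)%N -> L x -> tau m (tau n x) = tau m x.
Hypothesis tower' : forall m n x, (m <= n)%N -> L x -> tau n (tau m x) = tau m x.

Lemma fixp_filtration m n x : (m <= n)%N -> fixp L (tau m) x -> fixp L (tau n) x.
Proof. by move=> mn [lx hx]; split=> //; rewrite -hx tower'. Qed.

(** The signed elements that occur below are unbounded, and expect handles
   positive elements; identities between expectations are therefore kept in
   this form. *)
Definition same x y := [/\ 0 <= x, 0 <= y &
  exists v, expect L (tau 0%N) x v /\ expect L (tau 0%N) y v].

Lemma same0 : same 0 0.
Proof.
split=> //; exists (tau 0%N 0); have := expect_L dL (ht 0%N) (ideal0 dL) (lexx 0).
by split.
Qed.

Lemma sameD x y x' y' : same x y -> same x' y' -> same (x + x') (y + y').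
Proof.
move=> [x0 y0 [v [hx hy]]] [x0' y0' [v' [hx' hy']]]; split;
  [exact: raddr_ge0 | exact: raddr_ge0 |].
by exists (v + v'); split; apply: (expectD dedA dL (ht 0%N)).
Qed.

Lemma same_sym x y : same x y -> same y x.
Proof. by move=> [x0 y0 [v [hx hy]]]; split=> //; exists v. Qed.

Lemma same_trans x y z : same x y -> same y z -> same x z.
Proof.
move=> [x0 y0 [v [hx hy]]] [_ z0 [w [hy' hz]]]; split=> //; exists v; split => //.
by rewrite (expect_uniq hy hy').
Qed.

Variables (u w : A) (a b : nat -> A) (vu vw : A).
Hypotheses (u0 : 0 <= u) (w0 : 0 <= w).
Hypothesis hvu : expect L (tau 0%N) u vu.
Hypothesis hvw : expect L (tau 0%N) w vw.
Hypothesis ha : forall n, expect L (tau n) u (a n).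
Hypothesis hb : forall n, expect L (tau n) w (b n).

(** Multiplication by an element measurable at time m does not distinguish F
   from its conditional expectations at later times. *)
Lemma same_avg (c : R) m n p F v (g : nat -> A) : 0 <= F ->
  (forall n, expect L (tau n) F (g n)) -> expect L (tau 0%N) F v ->
  (m <= n)%N -> fixp L (tau m) p -> 0 < c -> 0 <= p -> p <= sc c ->
  same (p * F) (p * g n).
Proof.
move=> F0 hg hv mn fp c0 p0 pc.
have g0 : 0 <= g n := expect_ge0 dL (ht n) F0 (hg n).
split; [exact: fmul_ge0 | exact: fmul_ge0 |].
apply: (expect_avg dedA dL (ht 0%N) (ht n) _ (fixp_filtration mn fp) c0 p0 pc F0 (hg n) hv).
by move=> x lx; apply: tower.
Qed.

Variable lam : R.
Hypothesis lam0 : 0 < lam.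
Let l : A := sc lam.
Let m n : A := a n + b n.
Let f n : A := a n - b n.

(** The stopping rule looks at the majorant m instead of |f|: as a conditional
   expectation of u + w it is a supremum of fixed points, which makes the event
   r n measurable by monotone limits, and it keeps both a and b bounded before
   the stopping time. *)
Let r n : A := chi (m n - l).
Fixpoint survive n : A := if n is n'.+1 then survive n' * (1 - r n) else 1 - r 0%N.
Local Notation q := survive.

(** The square of the n-th square function of a - b. *)
Fixpoint sqsum n : A :=
  if n is n'.+1 then sqsum n' + (f n - f n') * (f n - f n') else f 0%N * f 0%N.

Lemma plus_ge0 n : 0 <= a n. Proof. exact: (expect_ge0 dL (ht n) u0 (ha n)). Qed.
Lemma minus_ge0 n : 0 <= b n. Proof. exact: (expect_ge0 dL (ht n) w0 (hb n)). Qed.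
Lemma majorant_ge0 n : 0 <= m n. Proof. by rewrite raddr_ge0 ?plus_ge0 ?minus_ge0. Qed.

Lemma expect_majorant n : expect L (tau n) (u + w) (m n).
Proof. exact: (expectD dedA dL (ht n)). Qed.

Lemma stop_idem n : idem (r n). Proof. exact: chi_idem. Qed.

Lemma survive_idem n : idem (q n).
Proof. by elim: n => [|n IH]; [|apply: idemM => //]; apply/idemC/stop_idem. Qed.

Lemma sqsum_ge0 n : 0 <= sqsum n.
Proof. by elim: n => [|n IH]; [|apply: raddr_ge0 => //]; exact: fsqr_ge0. Qed.

Lemma stop_fix n : fixp L (tau n) (r n).
Proof. by apply: (meas_chi (ht n)); apply: (meas_expect (ht n) _ (expect_majorant n));
  apply: raddr_ge0. Qed.

Lemma nat_ge0 k : 0 <= k%:R :> A.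
Proof. by have := fconst_ge0 h (ler0n R k); rewrite /fconst scaler_nat. Qed.

Lemma idem_le_fconst1 p : idem p -> p <= sc 1. Proof. by rewrite fconst1; exact: idem_le1. Qed.

Lemma survive_fix n : fixp L (tau n) (q n).
Proof.
have fc k : fixp L (tau k) (1 - r k) by apply: (fixpB dL (ht k));
  [exact: fixp1 | exact: stop_fix].
elim: n => [|n IH] //=.
apply: (fixpM (ht n.+1) (c := 1)) => //; try exact/idem_ge0/survive_idem.
- by apply: fixp_filtration IH.
- exact/idem_le_fconst1/survive_idem.
- exact/idem_ge0/idemC/stop_idem.
Qed.

Lemma survive_stop n k : (k <= n)%N -> q n * rpos (m k - l) = 0.
Proof.
elim: n => [|n IH] /=; first by rewrite leqn0 => /eqP->; apply: chiC_pos.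
rewrite leq_eqVlt => /orP[/eqP->|/IH e].
  by rewrite -mulrA chiC_pos// mulr0.
by rewrite mulrAC e mul0r.
Qed.

Lemma survive_bound n : 0 <= l * q n - q n * m n.
Proof.
have -> : l * q n - q n * m n = q n * - (m n - l) by ring.
rewrite -(rposBneg (m n - l)) opprB mulrBr survive_stop// subr0.
by rewrite fmul_ge0 ?rneg_ge0//; apply/idem_ge0/survive_idem.
Qed.

(** The estimate behind both parts. On the stopped martingale,
   sqsum n - f_n^2 telescopes into the martingale transform
   -2 sum f_{k-1} (f_k - f_{k-1}), whose multipliers are bounded by lam and
   whose expectation therefore vanishes (this is P and Q), plus the jump at the
   time of stopping, which is at most 2 lam times the majorant there (this is
   H). *)
Lemma stopped_estimate n : exists P Q H, [/\ same P Q, same H ((1 - q n) * (u + w)),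
  l * (1 - q n) <= H & q n * (sqsum n - f n * f n) + Q <= P + 2 * l * H].
Proof.
have l0 : 0 <= l by apply/fconst_ge0/ltW.
have uw0 : 0 <= u + w by apply: raddr_ge0.
have hvuw := expectD dedA dL (ht 0%N) u0 w0 hvu hvw.
have sH k p : fixp L (tau k) p -> idem p -> same (p * m k) (p * (u + w)).
  move=> fp ip; apply: same_sym.
  by apply: (same_avg uw0 expect_majorant hvuw (leqnn k) fp ltr01 (idem_ge0 ip) (idem_le_fconst1
    ip)).
have rm k : 0 <= r k * m k - l * r k.
  have -> : r k * m k - l * r k = r k * (m k - l) by ring.
  exact: chi_mul_ge0.
elim: n => [|n [P [Q [H [sPQ sHq lH main]]]]].
  exists 0, 0, (r 0%N * m 0%N); rewrite /= opprB addrC subrK; split.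
  - exact: same0.
  - by apply: sH; [apply: stop_fix | apply: stop_idem].
  - by rewrite -rsub_ge0.
  - by rewrite subrr mulr0 addr0 add0r !fmul_ge0 ?nat_ge0 ?majorant_ge0//;
      apply/idem_ge0/stop_idem.
have q0 := idem_ge0 (survive_idem n); have r0 := idem_ge0 (stop_idem n.+1).
have ai k := plus_ge0 k; have bi k := minus_ge0 k.
pose al := q n * a n; pose be := q n * b n.
have hle k x : 0 <= x -> x <= m k -> q k * x <= l.
  move=> x0 xm; apply: (@le_trans _ _ (q k * m k)); first by apply: fle_mull => //;
    apply/idem_ge0/survive_idem.
  apply: (@le_trans _ _ (l * q k)); first by rewrite -rsub_ge0 survive_bound.
  by rewrite mulrC; apply: idem_mul_le => //; apply: survive_idem.
have fal : fixp L (tau n) al.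
  apply: (meas_mul (ht n) (survive_fix n) ltr01 q0 (idem_le_fconst1 (survive_idem n)) _ (d :=
    lam)).
    exact: (meas_expect (ht n) u0 (ha n)).
  by apply: hle => //; apply: rle_addr.
have fbe : fixp L (tau n) be.
  apply: (meas_mul (ht n) (survive_fix n) ltr01 q0 (idem_le_fconst1 (survive_idem n)) _ (d :=
    lam)).
    exact: (meas_expect (ht n) w0 (hb n)).
  by apply: hle => //; apply: rle_addl.
have al0 : 0 <= al by apply: fmul_ge0.
have be0 : 0 <= be by apply: fmul_ge0.
have all : al <= sc lam by apply: hle => //; apply: rle_addr.
have bel : be <= sc lam by apply: hle => //; apply: rle_addl.
have st p F v g : 0 <= F -> (forall n, expect L (tau n) F (g n)) -> expect L (tau 0%N) F v ->
    fixp L (tau n) p -> 0 <= p -> p <= sc lam -> same (p * g n.+1) (p * g n).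
  move=> F0 hg hv fp p0 pl; apply: (same_trans _ (same_avg F0 hg hv (leqnn n) fp lam0 p0 pl)).
  exact: (same_sym (same_avg F0 hg hv (leqnSn n) fp lam0 p0 pl)).
have saa := st _ _ _ _ u0 ha hvu fal al0 all.
have sba := st _ _ _ _ u0 ha hvu fbe be0 bel.
have sab := st _ _ _ _ w0 hb hvw fal al0 all.
have sbb := st _ _ _ _ w0 hb hvw fbe be0 bel.
pose Pk := be * a n.+1 + al * b n.+1 + al * a n + be * b n.
pose Qk := be * a n + al * b n + al * a n.+1 + be * b n.+1.
have sk : same Pk Qk.
  by apply: sameD; [apply: sameD; [apply: sameD|apply: same_sym]|apply: same_sym].
exists (P + (Pk + Pk)), (Q + (Qk + Qk)), (H + q n * r n.+1 * m n.+1); split.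
- by apply: sameD => //; apply: sameD.
- have -> : (1 - q n.+1) * (u + w) = (1 - q n) * (u + w) + q n * r n.+1 * (u + w).
    by rewrite /=; ring.
  apply: sameD => //; apply: sH; last by apply: idemM; [exact: survive_idem | exact: stop_idem].
  apply: (fixpM (ht n.+1) (c := 1)) => //; last exact: stop_fix.
    by apply: fixp_filtration (survive_fix n).
  exact/idem_le_fconst1/survive_idem.
- rewrite -rsub_ge0 /=.
  have -> : H + q n * r n.+1 * m n.+1 - l * (1 - q n * (1 - r n.+1)) =
     (H - l * (1 - q n)) + q n * (r n.+1 * m n.+1 - l * r n.+1) by ring.
  by rewrite raddr_ge0// ?rsub_ge0// fmul_ge0.
rewrite -rsub_ge0 /=.
set S := sqsum n in main *.
have S0 : 0 <= S by apply: sqsum_ge0.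
have -> : P + (Pk + Pk) + 2 * l * (H + q n * r n.+1 * m n.+1) -
   (q n * (1 - r n.+1) * (S + (f n.+1 - f n) * (f n.+1 - f n) - f n.+1 * f n.+1) +
    (Q + (Qk + Qk))) =
   (P + 2 * l * H - (q n * (S - f n * f n) + Q)) + q n * r n.+1 * S +
   q n * r n.+1 * (f n * f n) + 2 * r n.+1 * ((l * q n - q n * m n) * m n.+1) +
   4 * (q n * r n.+1 * (a n * b n.+1 + b n * a n.+1)).
  by rewrite /Pk /Qk /al /be /f /m; ring.
have qr0 : 0 <= q n * r n.+1 by apply: fmul_ge0.
apply: (raddr_ge0 (raddr_ge0 (raddr_ge0 (raddr_ge0 _ _) _) _) _); rewrite ?rsub_ge0//;
  apply: fmul_ge0 => //.
- exact: fsqr_ge0.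
- by apply: fmul_ge0 => //; apply: nat_ge0.
- by apply: fmul_ge0; [apply: survive_bound | apply: majorant_ge0].
- exact: nat_ge0.
- by apply: fmul_ge0 => //; apply: raddr_ge0; apply: fmul_ge0.
Qed.

Section Conclusions.
Variable n : nat.
Let c : A := vu + vw.

Lemma expect_total : expect L (tau 0%N) (u + w) c.
Proof. exact: (expectD dedA dL (ht 0%N)). Qed.

Lemma ideal_idem p : idem p -> L p.
Proof. by move=> hp; apply: (di_solid dL (di_one dL)); [exact: idem_ge0 | exact: idem_le1]. Qed.

Lemma expect_idem (k : R) p : 0 < k -> idem p ->
  expect L (tau 0%N) (sc k * p) (k *: tau 0%N p).
Proof.
move=> k0 hp; rewrite -fscaleE; have lp := ideal_idem hp.
by apply: (expectZ dedA dL (ht 0%N)) => //; [|apply: (expect_L dL (ht 0%N))]; rewrite // idem_ge0.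
Qed.

Lemma expect_fconst (k : R) x v : 0 < k -> 0 <= x -> expect L (tau 0%N) x v ->
  expect L (tau 0%N) (sc k * x) (k *: v).
Proof. by move=> k0 x0 hv; rewrite -fscaleE; apply: (expectZ dedA dL (ht 0%N)). Qed.

(** Doob's maximal inequality: H in the estimate above dominates lam (1 - q n)
   and has the expectation of (1 - q n) (u + w). *)
Lemma weak_maximal : lam *: tau 0%N (1 - q n) <= c.
Proof.
have [P [Q [H [_ [H0 _ [v [hH hv]]] lH _]]]] := stopped_estimate n.
have iq := idemC (survive_idem n).
apply: (@le_trans _ _ v).
  exact: (expect_mono lH (expect_idem lam0 iq) hH).
apply: (expect_mono _ hv expect_total); apply: idem_mul_le => //; exact: raddr_ge0.
Qed.

(** The indicator of the part where the square function exceeds lam. *)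
Let d : A := chi (sqsum n - sc (lam * lam)).

(** Burkholder's inequality. The stopped part costs one c; on the rest, the
   Markov inequality for q n * sqsum n costs two more, since the expectation of
   q n * sqsum n is at most 2 lam c. *)
Lemma weak_square : lam *: tau 0%N (1 - q n * (1 - d)) <= 3 *: c.
Proof.
have [P [Q [H [sPQ [H0 g0 [v [hH hv]]] lH main]]]] := stopped_estimate n.
have iq := survive_idem n; have id : idem d by apply: chi_idem.
have q0 := idem_ge0 iq; have d0 := idem_ge0 id.
have l0 : 0 <= l by apply/fconst_ge0/ltW.
have idq : idem (d * q n) by apply: idemM.
have [P0 Q0 [vp [hP hQ]]] := sPQ.
have uw0 : 0 <= u + w by apply: raddr_ge0.
have [_ qm0 [vq [hqu hqm]]] := same_avg uw0 expect_majorant expect_total (leqnn n) (survive_fix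
  n) ltr01 q0 (idem_le_fconst1 iq).
have hsum : v + vq = c.
  have := expectD dedA dL (ht 0%N) g0 (fmul_ge0 q0 uw0) hv hqu.
  have -> : (1 - q n) * (u + w) + q n * (u + w) = u + w by ring.
  by move=> e; apply: (expect_uniq e expect_total).
have vq0 : 0 <= vq := expect_ge0 dL (ht 0%N) qm0 hqm.
have ineq : sc (lam * lam) * (d * q n) + Q <= P + (l * H + l * H + l * (q n * m n)).
  rewrite -rsub_ge0.
  have -> : P + (l * H + l * H + l * (q n * m n)) - (sc (lam * lam) * (d * q n) + Q) =
    (P + 2 * l * H - (q n * (sqsum n - f n * f n) + Q)) + q n * (d * (sqsum n - sc (lam * lam)))
    + q n * ((1 - d) * sqsum n) + (l * q n - q n * m n) * m n + 4 * (q n * (a n * b n)).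
    by rewrite /f /m; ring.
  apply: (raddr_ge0 (raddr_ge0 (raddr_ge0 (raddr_ge0 _ _) _) _) _); rewrite ?rsub_ge0//;
    apply: fmul_ge0 => //.
  - exact: chi_mul_ge0.
  - by apply: fmul_ge0; [exact/idem_ge0/idemC | apply: sqsum_ge0].
  - exact: survive_bound.
  - exact: majorant_ge0.
  - exact: nat_ge0.
  - by apply: fmul_ge0 => //; apply: fmul_ge0; [apply: plus_ge0 | apply: minus_ge0].
have ll0 : 0 < lam * lam by apply: mulr_gt0.
have pos1 : 0 <= sc (lam * lam) * (d * q n) by apply: fmul_ge0;
  [apply/fconst_ge0/ltW | apply: fmul_ge0].
have lH0 : 0 <= l * H by apply: fmul_ge0.
have E1 := expectD dedA dL (ht 0%N) pos1 Q0 (expect_idem ll0 idq) hQ.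
have EH := expect_fconst lam0 H0 hH.
have EHH := expectD dedA dL (ht 0%N) lH0 lH0 EH EH.
have E2 := expectD dedA dL (ht 0%N) (raddr_ge0 lH0 lH0) (fmul_ge0 l0 qm0) EHH (expect_fconst
  lam0 qm0 hqm).
have E3 := expectD dedA dL (ht 0%N) P0 (raddr_ge0 (raddr_ge0 lH0 lH0) (fmul_ge0 l0 qm0)) hP E2.
have := expect_mono ineq E1 E3.
rewrite [vp + _]addrC rleD2r -!scalerDr -scalerA rscale_le// => k1.
have k2 := weak_maximal.
have -> : 1 - q n * (1 - d) = (1 - q n) + d * q n by ring.
rewrite (cx_add (ht 0%N)); try by apply: ideal_idem => //; apply: idemC.
rewrite [lam *: _]scalerDr.
apply: (@le_trans _ _ (c + (c + c))).
  apply: rleD => //; apply: le_trans k1 _.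
  rewrite -hsum -rsub_ge0.
  by have -> : v + vq + (v + vq) - (v + v + vq) = vq by ring.
by rewrite scaler_nat !mulrS mulr0n addr0.
Qed.

End Conclusions.
End Core.

(** * The base space inside its universal completion *)

Section Embedding.
Variables (R : realType) (E U : rieszType R) (j : {linear E -> U}).
Hypothesis dedE : dedekind_complete [set: E].
Hypothesis hU : universal_completion j.
Implicit Types (x y g : E) (X Y : set E).

Lemma emb_le x y : (j x <= j y) = (x <= y).
Proof.
apply/idP/idP => xy; last by rewrite -(rjoin_r xy) (uc_join hU) rle_joinl.
have : rjoin x y = y by apply: (uc_inj hU); rewrite (uc_join hU) rjoin_r.
by move=> <-; apply: rle_joinl.
Qed.

Lemma emb_ge0 x : (0 <= j x) = (0 <= x).
Proof. by rewrite -[X in X <= _](raddf0 j) emb_le. Qed.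

Lemma emb_meet x y : j (rmeet x y) = rmeet (j x) (j y).
Proof.
apply: (addrI (rjoin (j x) (j y))).
by rewrite rjoin_meet -(uc_join hU) -!raddfD rjoin_meet.
Qed.

Lemma emb_pos x : j (rpos x) = rpos (j x).
Proof. by rewrite /rpos (uc_join hU) raddf0. Qed.

(** The embedding preserves suprema because its range is order dense. *)
Lemma emb_sups X x : X !=set0 -> supremums X x -> supremums (j @` X) (j x).
Proof.
move=> X0 sX; apply: mk_sups => [_ [y Xy <-]|t ht]; first by rewrite emb_le (sups_ub sX).
set w := j x - rmeet (j x) t; have w0 : 0 <= w by rewrite rsub_ge0 rmeet_lel.
suff : w = 0 by move/eqP; rewrite subr_eq0 => /eqP->; apply: rmeet_ler.
apply/eqP/negP => /negP wn; have : 0 < w by rewrite lt_neqAle eq_sym wn.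
move=> /(uc_order_dense hU)[y [y0 yw]].
have : x <= x - y.
  apply: (sups_le sX) => z Xz; rewrite -emb_le raddfB.
  apply: (@le_trans _ _ (rmeet (j x) t)).
    by rewrite rmeet_ge emb_le (sups_ub sX Xz) /=; apply: ht; exists z.
  by rewrite rleBrDr addrC -rleBrDr.
rewrite rleBrDr -{2}(addr0 x) rleD2l -emb_le raddf0 => yle.
by have := lt_le_trans y0 yle; rewrite ltxx.
Qed.

Lemma emb_sups_inv X x : supremums (j @` X) (j x) -> supremums X x.
Proof.
move=> sX; apply: mk_sups => [y Xy|t ht].
  by rewrite -emb_le; apply: (sups_ub sX); exists y.
by rewrite -emb_le; apply: (sups_le sX) => _ [y Xy <-]; rewrite emb_le ht.
Qed.

Definition minorants (u : U) : set E := [set g | 0 <= g /\ j g <= u].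

(** By Dedekind completeness of the base space, the supremum of the minorants
   of u lies in it; by order density it is u. *)
Lemma emb_solid x (u : U) : 0 <= u -> u <= j x -> exists y, j y = u.
Proof.
move=> u0 ux.
have X0 : minorants u !=set0 by exists 0; split; rewrite ?raddf0.
have [s hs] : exists s, supremums (minorants u) s.
  apply: (ded_sup dedE X0 (b := x)) => g [_ gu].
  by rewrite -emb_le; apply: le_trans ux.
exists s; apply/le_anti/andP; split.
  by apply: (sups_le (emb_sups X0 hs)) => _ [g [_ gu] <-].
have su : j s <= u by apply: (sups_le (emb_sups X0 hs)) => _ [g [_ gu] <-].
rewrite -rsub_le0; apply/negP => /negP wn.
have : 0 < u - j s.
  by rewrite lt_neqAle rsub_ge0 su andbT eq_sym; apply: contraNN wn => /eqP->.
move=> /(uc_order_dense hU)[y [y0 yw]].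
have y0' : 0 <= y by rewrite -emb_ge0 ltW.
have : s <= s - y.
  apply: (sups_le hs) => g [g0 gu]; rewrite rleBrDr; apply: (sups_ub hs); split.
    exact: raddr_ge0.
  rewrite raddfD -[u](subrK (j s)) addrC [_ + j s]addrC [j y + _]addrC; apply: rleD => //.
  by rewrite emb_le; apply: (sups_ub hs).
rewrite rleBrDr -{2}(addr0 s) rleD2l -emb_le raddf0 => yle.
by have := lt_le_trans y0 yle; rewrite ltxx.
Qed.

(** * The base space inside its sup-completion *)

Variables (S : orderedConeType R) (i : E -> S).
Hypothesis hS : sup_completion i.
Implicit Types (t : S).

Lemma sc_sups (B : set S) : B !=set0 -> supremums B (supremum (i 0) B).
Proof.
move=> B0; have [top ht] := sc_top hS.
have [|s [_ h1 h2]] := sc_dedekind hS (fun z _ => I : [set: S] z) B0.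
  by exists top => // z _; apply: ht.
rewrite /supremum; case: ifPn => [/eqP e|_]; first by case: B0 => z; rewrite e.
case: xgetP => [? -> //|/(_ s)[]]; split=> // t Bt; exact: h2.
Qed.

(** The supremum of i X lies below i x, hence in the base space by solidity, and
   so it is the supremum computed there. *)
Lemma sc_emb_sups X x t : supremums X x -> X !=set0 ->
  (forall y, X y -> i y <= t) -> i x <= t.
Proof.
move=> sX X0 hX; have iX0 : i @` X !=set0 by case: X0 => y Xy; exists (i y), y.
have hs := sc_sups iX0; set s := supremum _ _ in hs.
have sx : s <= i x.
  by case: hs => _; apply => _ [y Xy <-]; rewrite (sc_le hS) (sups_ub sX).
have [x' e] := sc_solid hS sx.
apply: (@le_trans _ _ s); last by case: hs => _; apply => _ [y Xy <-]; apply: hX.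
rewrite e (sc_le hS); apply: (sups_le sX) => y Xy; rewrite -(sc_le hS) -e.
by case: hs => h1 _; apply: h1; exists y.
Qed.

Lemma minorants_neq0 (u : U) : 0 <= u -> minorants u !=set0.
Proof. by move=> u0; exists 0; split; rewrite ?raddf0. Qed.

Lemma u_to_s_sups (u : U) : 0 <= u -> supremums (i @` minorants u) (u_to_s i j u).
Proof.
by move=> /minorants_neq0[g hg]; apply: sc_sups; exists (i g), g.
Qed.

Lemma below_u_to_s (u : U) : 0 <= u -> below i (u_to_s i j u) = minorants u.
Proof.
move=> u0; apply/seteqP; split=> g [g0 hg]; split => //; last first.
  by have [h1 _] := u_to_s_sups u0; apply: h1; exists g.
have X0 := minorants_neq0 u0.
have sg := sc_sup_meet hS X0 (u_to_s_sups u0) hg.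
have X1 : [set rmeet g a | a in minorants u] !=set0 by case: X0 => x Xx; exists (rmeet g x), x.
apply: (sups_le (emb_sups X1 sg)) => _ [_ [x [_ xu] <-] <-].
by rewrite emb_meet; apply: le_trans (rmeet_ler _ _) xu.
Qed.

Hypothesis dedU : dedekind_complete [set: U].

Lemma minorants_sups (u : U) : 0 <= u -> supremums (j @` minorants u) u.
Proof.
move=> u0; have X0 : j @` minorants u !=set0 by have [g hg] := minorants_neq0 u0; exists (j g), g.
have [s hs] : exists s, supremums (j @` minorants u) s.
  by apply: (ded_sup dedU X0 (b := u)) => _ [g [_ gu] <-].
have su : s <= u by apply: (sups_le hs) => _ [g [_ gu] <-].
suff e : u = s by move: hs; rewrite -e.
apply/eqP/negP => /negP ne; have : 0 < u - s by rewrite lt_neqAle rsub_ge0 su eq_sym subr_eq0 ne.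
move=> /(uc_order_dense hU)[x [x0 xle]].
have : s <= s - j x.
  apply: (sups_le hs) => _ [y [y0 ya] <-]; rewrite rleBrDr; apply: (sups_ub hs).
  exists (y + x); last by rewrite raddfD.
  split; first by apply: raddr_ge0 => //; rewrite -emb_ge0 ltW.
  rewrite raddfD -[u](subrK s) [_ + s]addrC; apply: rleD => //.
  by apply: (sups_ub hs); exists y.
rewrite rleBrDr -{2}(addr0 s) rleD2l => hx.
by have := lt_le_trans x0 hx; rewrite ltxx.
Qed.

(** The identification of positive elements of the universal completion with
   elements of the sup-completion matches suprema of the same family. *)
Lemma s_to_u_sup Y (a : U) : (forall y, Y y -> 0 <= y) -> Y !=set0 ->
  supremums (j @` Y) a -> s_to_u i j (supremum (i 0) (i @` Y)) = a.
Proof.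
move=> hY Y0 sY.
have iY0 : i @` Y !=set0 by case: Y0 => y Yy; exists (i y), y.
have a0 : 0 <= a.
  have [y Yy] := Y0; apply: (@le_trans _ _ (j y)); first by rewrite emb_ge0 hY.
  by apply: (sups_ub sY); exists y.
set s := supremum _ _; have hs : supremums (i @` Y) s := sc_sups iY0.
have e : u_to_s i j a = s.
  apply: (is_subset1_supremums (u_to_s_sups a0)); split=> [_ [g [g0 ga] <-]|t ht].
    have sg : supremums (j @` [set rmeet y g | y in Y]) (j g).
      have := sups_meet (j g) sY; rewrite rmeet_r//; congr supremums.
      by rewrite !image_comp; apply: eq_imagel => y _ /=; rewrite emb_meet.
    apply: (sc_emb_sups (emb_sups_inv sg)); first by have [y Yy] := Y0; exists (rmeet y g), y.
    move=> _ [y Yy <-]; apply: (@le_trans _ _ (i y)); first by rewrite (sc_le hS) rmeet_lel.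
    by case: hs => h1 _; apply: h1; exists y.
  case: hs => _; apply => _ [y Yy <-]; apply: ht; exists y => //; split; first exact: hY.
  by apply: (sups_ub sY); exists y.
rewrite /s_to_u; case: xgetP => [z _ [z0 ez]|/(_ a)[]//].
have eza : minorants z = minorants a by rewrite -!below_u_to_s// ez e.
by apply: (sups_uniq (minorants_sups z0)); rewrite eza; apply: minorants_sups.
Qed.

End Embedding.

(** * Transfer to the universal completion *)

Section CondExp.
Variables (R : realType) (E : rieszType R) (e : E) (P : {linear E -> E}).
Hypothesis hP : cond_expectation e P.

Lemma ce_mono (x y : E) : x <= y -> P x <= P y.
Proof.
rewrite -rsub_ge0 -[P x <= _]rsub_ge0 -raddfB le_eqVlt => /orP[/eqP<-|].
  by rewrite raddf0.
by move=> /(ce_strictly_pos hP)/ltW.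
Qed.

(** Order continuity for the increasing net formed by X indexed by itself. *)
Lemma ce_sups (X : set E) x : X !=set0 -> dirset X -> supremums X x ->
  supremums (P @` X) (P x).
Proof.
move=> [x0 X0] dX sX.
pose I := {y : E | X y}; pose r (a b : I) := is_true (sval a <= sval b).
have dr : directed r.
  split.
  - exact: (inhabits (exist _ x0 X0)).
  - by move=> a; rewrite /r.
  - by move=> a b c; apply: le_trans.
  - move=> [a Xa] [b Xb]; have [c [Xc ac bc]] := dX _ _ Xa Xb.
    by exists (exist _ c Xc).
have cv : order_cvg r (fun a : I => sval a) x.
  exists (fun a => x - sval a); split.
  - by move=> a b ab; rewrite rleD2l rleN2.
  - split=> [_ [[a Xa] _ <-]|t ht]; first by rewrite rsub_ge0 (sups_ub sX).
    have : x <= x - t.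
      apply: (sups_le sX) => y Xy; rewrite rleBrDr addrC -rleBrDr.
      by apply: ht; exists (exist _ y Xy).
    by rewrite rleBrDr -{2}(addr0 x) rleD2l.
  - move=> [a Xa] /=; rewrite -rabsN opprB rabs_id// rsub_ge0; exact: (sups_ub sX).
have [y [_ [ylb yglb] hy]] := ce_order_continuous hP dr cv.
apply: mk_sups => [_ [z Xz <-]|b hb]; first exact/ce_mono/(sups_ub sX).
rewrite -rsub_le0; apply: yglb => _ [[a Xa] _ <-].
apply: le_trans (hy _) => /=; apply: le_trans (rleN_abs _); rewrite opprB rleD2l rleN2.
by apply: hb; exists a.
Qed.

End CondExp.

Section Main.
Variables (R : realType) (E : rieszType R) (e : E).
Hypotheses (dedE : dedekind_complete [set: E]) (he : weak_order_unit e).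
Variables (U : rieszType R) (j0 : {linear E -> U}) (hU0 : universal_completion j0).
Variables (mul : U -> U -> U) (hmul : f_algebra mul (j0 e)).
Variables (S : orderedConeType R) (i : E -> S) (hS : sup_completion i).
Variables (T : nat -> {linear E -> E}) (hT : filtration e T).

Local Notation A := (falg hmul).
Local Notation sc := (fconst hmul).
Let j : {linear E -> A} := j0.

Lemma completionA : universal_completion j.
Proof. by case: hU0 => *; split. Qed.

Lemma dedA : dedekind_complete [set: A]. Proof. by case: (uc_complete completionA). Qed.
Lemma latA : laterally_complete A. Proof. by case: (uc_complete completionA). Qed.
Lemma emb_e : j e = 1. Proof. by []. Qed.

Definition baseL : set A := range j.
Definition jinv (u : A) : E := xget 0 [set x | j x = u].
Definition tau n (u : A) : A := j (T n (jinv u)).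

Lemma jinvK x : jinv (j x) = x.
Proof.
rewrite /jinv; case: xgetP => [y _ /(uc_inj completionA)//|/(_ x)]; by case.
Qed.

Lemma tauE n x : tau n (j x) = j (T n x). Proof. by rewrite /tau jinvK. Qed.

Lemma baseL_dense : dense_ideal baseL.
Proof.
split.
- split; first by exists 0 => //; rewrite raddf0.
    by move=> _ _ [x _ <-] [y _ <-]; exists (x + y) => //; rewrite raddfD.
  by move=> k _ [x _ <-]; exists (k *: x) => //; rewrite linearZ.
- by move=> x _ [y _ <-] x0 xy; have [z <-] := emb_solid dedE completionA x0 xy; exists z.
- by move=> u /(uc_order_dense completionA)[x [x0 xu]]; exists (j x) => //; exists x.
- by move=> _ _ [x _ <-] [y _ <-]; exists (rjoin x y) => //; rewrite (uc_join completionA).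
- by exists e.
Qed.

Lemma emb_lt x y : (j x < j y) = (x < y).
Proof. by rewrite !lt_neqAle (emb_le completionA) (inj_eq (uc_inj completionA)). Qed.

Lemma tau_cexp n : cexp baseL (tau n).
Proof.
have hP := hT.1 n; split.
- by move=> _ [x _ <-]; rewrite tauE; exists (T n x).
- by move=> _ _ [x _ <-] [y _ <-]; rewrite -raddfD !tauE !raddfD.
- by move=> k _ [x _ <-]; rewrite -linearZ !tauE !linearZ.
- move=> _ [x _ <-]; rewrite tauE -[X in X < _](raddf0 j) emb_lt => x0.
  by rewrite -(raddf0 j) emb_lt; apply: (ce_strictly_pos hP).
- move=> X z LX X0 dX sX [x _ ex]; move: sX; rewrite -ex tauE => sX.
  pose Y := [set y | X (j y)].
  have eX : X = j @` Y.
    apply/seteqP; split=> [u Xu|_ [y Yy <-]//].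
    by have [y _ ey] := LX _ Xu; exists y => //; rewrite /Y /= ey.
  have Y0 : Y !=set0 by move: X0; rewrite eX => -[_ [y Yy _]]; exists y.
  have dY : dirset Y.
    move=> a b Ya Yb; have [c [Xc ac bc]] := dX _ _ Ya Yb.
    have [t _ et] := LX _ Xc; exists t; rewrite -et in Xc ac bc.
    by split => //; rewrite -(emb_le completionA).
  have sY : supremums Y x by apply: (emb_sups_inv completionA); rewrite -eX.
  have TY0 : T n @` Y !=set0 by have [y Yy] := Y0; exists (T n y), y.
  have := emb_sups completionA TY0 (ce_sups hP Y0 dY sY); congr supremums.
  by rewrite eX !image_comp; apply: eq_imagel => y _ /=; rewrite tauE.
- by move=> _ [x _ <-]; rewrite !tauE (ce_idem hP).
- by rewrite -emb_e tauE (ce_unit hP).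
Qed.

Lemma tau_tower m n x : (m <= n)%N -> baseL x -> tau m (tau n x) = tau m x.
Proof. by move=> mn [y _ <-]; rewrite !tauE; have [_ ->] := hT.2 m n y mn. Qed.

Lemma tau_tower' m n x : (m <= n)%N -> baseL x -> tau n (tau m x) = tau m x.
Proof. by move=> mn [y _ <-]; rewrite !tauE; have [-> _] := hT.2 m n y mn. Qed.

Lemma tau_below n (u : A) : tau n @` below_in baseL u = j @` (T n @` minorants j u).
Proof.
rewrite image_comp; apply/seteqP; split=> [_ [x [[y _ <-] y0 yu] <-]|_ [x [x0 xu] <-]].
  by exists y; rewrite /= ?tauE//; split; rewrite // -(emb_ge0 completionA).
exists (j x); rewrite /= ?tauE//.
by split; [exists x | rewrite (emb_ge0 completionA) | ].
Qed.

(** The extension defined through the sup-completion is the one computed inside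
   the universal completion. *)
Lemma ext_expect n (u v : A) : 0 <= u -> expect baseL (tau n) u v ->
  s_to_u i j (ext_s i (T n) (u_to_s i j u)) = v.
Proof.
move=> u0; rewrite /expect tau_below => hv.
rewrite /ext_s (below_u_to_s completionA hS)//.
have -> : [set i (T n g) | g in minorants j u] = i @` (T n @` minorants j u) by rewrite
  image_comp.
apply: (s_to_u_sup completionA hS dedA) => //.
  move=> _ [y [y0 _] <-]; rewrite -(raddf0 (T n)).
  exact: (ce_mono (hT.1 n)).
by have [x hx] := minorants_neq0 j u0; exists (T n x), x.
Qed.

Lemma expect_le_exists n (u w v : A) : 0 <= u -> u <= w -> expect baseL (tau n) w v ->
  exists v', expect baseL (tau n) u v'.
Proof.
move=> u0 uw hv; apply: (ded_sup dedA (b := v)).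
  by have [x hx] := below_neq0 baseL_dense u0; exists (tau n x), x.
move=> _ [x [lx x0 xu] <-]; apply: (sups_ub hv); exists x => //; split => //.
exact: le_trans uw.
Qed.

Lemma L1_expect (u : A) : L1 i j (T 0%N) u ->
  exists v, expect baseL (tau 0%N) (rabs u) v.
Proof.
move=> [w w0 ew]; have u0 := rabs_ge0 u.
have wb g : minorants j (rabs u) g -> j (T 0%N g) <= w.
  move=> hg; have : below i (u_to_s i j w) (T 0%N g).
    split; first by rewrite -(raddf0 (T 0%N)); apply: (ce_mono (hT.1 0%N)); case: hg.
    rewrite ew /ext_s (below_u_to_s completionA hS)//; set B := (X in supremum _ X).
    have B0 : B !=set0 by exists (i (T 0%N g)), g.
    by have [h1 _] := sc_sups hS B0; apply: h1; exists g.
  by rewrite (below_u_to_s completionA hS)// => -[].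
apply: (ded_sup dedA (b := w)).
  by have [x hx] := below_neq0 baseL_dense u0; exists (tau 0%N x), x.
by rewrite tau_below => _ [_ [g hg <-] <-]; apply: wb.
Qed.

Lemma ext_signed n (u v w : A) : expect baseL (tau n) (rpos u) v ->
  expect baseL (tau n) (rneg u) w -> ext i j (T n) u = v - w.
Proof.
move=> hv hw; rewrite /ext.
by rewrite (ext_expect (rpos_ge0 u) hv) (ext_expect (rneg_ge0 u) hw).
Qed.

Lemma ext_pos n (u v : A) : 0 <= u -> expect baseL (tau n) u v -> ext i j (T n) u = v.
Proof.
move=> u0 hv; rewrite (@ext_signed _ _ v 0) ?subr0// ?rpos_id// rneg_0//.
have := expect_L baseL_dense (tau_cexp n) (ideal0 baseL_dense) (lexx 0).
by rewrite (cx0 baseL_dense (tau_cexp n)).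
Qed.

(** * Passing to the supremum *)

Lemma disjoint_band (d : E) : 0 <= d -> is_band [set x | rmeet (rabs x) d = 0].
Proof.
move=> d0; have mono (x y : E) : rabs x <= rabs y -> rmeet (rabs y) d = 0 -> rmeet (rabs x) d = 0.
  by move=> xy hy; apply: (rmeet0_le (rabs_ge0 x) d0 xy (lexx d)).
split.
- split=> /=.
  + by rewrite rabs_id// rmeet_l.
  + move=> x y hx hy.
    apply: (rmeet0_le (rabs_ge0 _) d0 (rabsD _ _) (lexx d)).
    by apply: rmeet0D => //; apply: rabs_ge0.
  + move=> k x hx.
    have le1 : rabs (k *: x) <= `|k| *: rabs x.
      rewrite rabs_le; have [k0|k0] := leP 0 k.
        by rewrite (ger0_norm k0) -scalerN !riesz_leZ ?rle_abs ?rleN_abs.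
      have ek : k *: x = - k *: - x by rewrite scaleNr scalerN opprK.
      rewrite (ltr0_norm k0) -scaleNr {1}ek.
      by rewrite !riesz_leZ ?rle_abs ?rleN_abs// oppr_ge0 ltW.
    apply: (rmeet0_le (rabs_ge0 _) d0 le1 (lexx d)).
    by apply: rmeet0Z => //; apply: rabs_ge0.
- by move=> x y hy xy; apply: mono hy.
- move=> X s hX sX.
  have [[x0 X0]|nX] := pselect (X !=set0); last first.
    (* the empty set has no supremum, since e > 0 *)
    have : s <= s - e by apply: (sups_le sX) => y Xy; case: nX; exists y.
    rewrite rleBrDr -{2}(addr0 s) rleD2l => e0.
    by have := lt_le_trans he.1 e0; rewrite ltxx.
  rewrite /= rabs_posneg; apply: rmeet0D => //; rewrite ?rpos_ge0 ?rneg_ge0//.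
    have XX : X !=set0 by exists x0.
    apply: (sup_meet0 (sups_join 0 XX sX)); first by exists (rjoin x0 0), x0.
    move=> _ [x Xx <-]; apply: (rmeet0_le (rpos_ge0 x) d0 _ (lexx d) (hX x Xx)).
    by rewrite rabs_posneg; apply: rle_addr; apply: rneg_ge0.
  apply: (rmeet0_le (rneg_ge0 s) d0 _ (lexx d) (hX _ X0)).
  apply: (@le_trans _ _ (rneg x0)).
    by apply: rjoin_mono => //; rewrite rleN2; apply: (sups_ub sX).
  by rewrite rabs_posneg; apply: rle_addl; apply: rpos_ge0.
Qed.

(** The component y of e lies in the band of elements disjoint from e - q, and
   y <= e = q + (e - q) then forces y <= q. *)
Lemma band_proj_le (X : set E) (q : E) : 0 <= q -> q <= e ->
  (forall x, X x -> 0 <= x /\ rmeet x (e - q) = 0) -> band_proj X e <= q.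
Proof.
move=> q0 qe hX; have d0 : 0 <= e - q by rewrite rsub_ge0.
have e0 : 0 <= e by apply: ltW; case: he.
(* without a component the value is 0 <= q *)
rewrite /band_proj; case: xgetP => [y _ [hy hdis]|_]; last by [].
have yd : rmeet (rabs y) (e - q) = 0.
  apply: (hy [set x | rmeet (rabs x) (e - q) = 0]); split; first exact: disjoint_band.
  by move=> x /hX[x0 hx] /=; rewrite rabs_id.
have ye : y <= e.
  rewrite -rsub_le0; suff <- : rpos (y - e) = 0 by apply: rle_pos.
  have h1 : rpos (y - e) <= rabs (e - y).
    by rewrite -rabsN opprB rabs_posneg; apply: rle_addr; apply: rneg_ge0.
  have h2 : rpos (y - e) <= rabs y.
    rewrite /rpos rjoin_le rabs_ge0 andbT; apply: le_trans (rle_abs y).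
    by rewrite rleBlDr; apply: rle_addr.
  have := rmeet0_le (rpos_ge0 _) (rpos_ge0 _) h1 h2 (hdis _ hy).
  by rewrite rmeet_l.
apply: le_trans (rle_pos y) _.
have pe : rpos y <= e by rewrite /rpos rjoin_le ye.
have pd : rmeet (rpos y) (e - q) = 0.
  apply: (rmeet0_le (rpos_ge0 _) d0 _ (lexx _) yd).
  by rewrite rabs_posneg; apply: rle_addr; apply: rneg_ge0.
rewrite -(rmeet_l pe) -[in X in rmeet _ X](subrK q e) rmeetC.
apply: le_trans (rmeetD_le d0 q0 (rpos_ge0 y)) _.
by rewrite [rmeet (e - q) _]rmeetC pd add0r rmeet_lel.
Qed.

(** By the distributive law of the sup-completion, g is the supremum of its
   meets with the members of X. *)
Lemma sc_disjoint (X : set E) s (g d : E) : X !=set0 -> supremums (i @` X) s ->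
  (forall x, X x -> 0 <= x /\ rmeet x d = 0) -> 0 <= g -> 0 <= d -> i g <= s -> rmeet g d = 0.
Proof.
move=> X0 sX hX g0 d0 gs; have sg := sc_sup_meet hS X0 sX gs.
apply: (sup_meet0 sg); first by have [x Xx] := X0; exists (rmeet g x), x.
move=> _ [x /hX[x0 hx] <-].
by apply: (rmeet0_le _ d0 (rmeet_ler _ _) (lexx d) hx); apply: rmeet_ge0.
Qed.

(** Let Z be the supremum of the indicators of v n > lam. Its expectation is
   controlled by order continuity, and every element of E below the excess is
   disjoint from 1 - Z: the excess is a supremum of terms (g - lam e)^+ with g
   below the supremum of the v n, and each such g is in turn the supremum of its
   meets with elements below a single v n. *)
Lemma weak_type_sup (v : nat -> A) (lam : R) (K : A) : 0 < lam -> (forall n, 0 <= v n) ->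
  (forall N, exists p, [/\ idem p, lam *: tau 0%N p <= K &
    forall n, (n <= N)%N -> (1 - p) * rpos (v n - sc lam) = 0]) ->
  lam *: j (T 0%N (band_proj_s i
    (excess i e (supremum (i 0) (range (fun n => u_to_s i j (v n)))) lam) e)) <= K.
Proof.
move=> lam0 v0 hN.
pose s := supremum (i 0) (range (fun n => u_to_s i j (v n))).
have hs : supremums (range (fun n => u_to_s i j (v n))) s.
  by apply: (sc_sups hS); exists (u_to_s i j (v 0%N)), 0%N.
rewrite -/s.
pose ch n : A := chi (v n - sc lam).
pose fix z (N : nat) : A := if N is N'.+1 then rjoin (z N') (ch N) else ch 0%N.
have zle N p : idem p -> (forall n, (n <= N)%N -> (1 - p) * rpos (v n - sc lam) = 0) -> z N <= p.
  move=> ip; elim: N => [|N IH] hp /=; first by apply: (chi_le dedA) => //; apply: hp.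
  rewrite rjoin_le IH => [|n nN]; last by apply: hp; apply: leqW.
  by apply: (chi_le dedA) => //; apply: hp.
have chz N : ch N <= z N by case: N => [|N] //=; apply: rle_joinr.
have z0 N : 0 <= z N by apply: le_trans (chz N); apply: (chi_ge0 dedA).
have z1 N : z N <= 1.
  by apply: zle; [exact: idem1 | move=> n _; rewrite subrr mul0r].
have zS m n : (m <= n)%N -> z m <= z n.
  move=> /subnKC<-; elim: (n - m)%N => [|k IH]; rewrite ?addn0// addnS.
  by apply: le_trans IH _; apply: rle_joinl.
have Lz N : baseL (z N) by apply: (di_solid baseL_dense (di_one baseL_dense)).
have zN0 : range z !=set0 by exists (z 0%N), 0%N.
have [Z hZ] : exists Z, supremums (range z) Z.
  by apply: (ded_sup dedA zN0 (b := 1)) => _ [n _ <-].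
have Z0 : 0 <= Z by apply: le_trans (z0 0%N) _; apply: (sups_ub hZ); exists 0%N.
have Z1 : Z <= 1 by apply: (sups_le hZ) => _ [n _ <-].
have LsupZ : baseL Z by apply: (di_solid baseL_dense (di_one baseL_dense)).
have tZ : lam *: tau 0%N Z <= K.
  have hs0 : supremums (tau 0%N @` range z) (tau 0%N Z).
    apply: (cx_sup (tau_cexp 0%N)) => //; first by move=> _ [n _ <-].
    move=> _ _ [m _ <-] [n _ <-]; exists (z (maxn m n)).
    by split; [exists (maxn m n) | apply: zS; apply: leq_maxl | apply: zS; apply: leq_maxr].
  apply: (sups_le (sups_scale lam0 hs0)) => _ [_ [_ [N _ <-] <-] <-].
  have [p [ip pK hp]] := hN N; apply: le_trans pK; rewrite rscale_le//.
  apply: (cx_mono baseL_dense (tau_cexp 0%N)) => //; last exact: zle.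
  by apply: (di_solid baseL_dense (di_one baseL_dense)); [exact: idem_ge0 | exact: idem_le1].
have [q _ eq] := LsupZ.
have q0 : 0 <= q by rewrite -(emb_ge0 completionA) eq.
have qe : q <= e by rewrite -(emb_le completionA) eq.
apply: le_trans tZ; rewrite -eq tauE rscale_le// (emb_le completionA).
apply: (ce_mono (hT.1 0%N)).
have d0 : 0 <= e - q by rewrite rsub_ge0.
have jd : j (e - q) = 1 - Z by rewrite -eq; exact: (raddfB j).
have vd n : rmeet (rpos (v n - sc lam)) (1 - Z) = 0.
  have h1 : rmeet (rpos (v n - sc lam)) (1 - ch n) = 0.
    apply: (mul_meet0 dedA); rewrite ?rpos_ge0 ?rsub_ge0 ?(chi_le1 dedA)//.
    by rewrite mulrC (chiC_pos dedA).
  apply: (rmeet0_le (rpos_ge0 _) _ (lexx _) _ h1); rewrite ?rsub_ge0//.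
  rewrite rleD2l rleN2; apply: le_trans (chz n) _; by apply: (sups_ub hZ); exists n.
have jpos g : j (rpos (g - lam *: e)) = rpos (j g - sc lam).
  have el : j (lam *: e) = sc lam by rewrite linearZ.
  by rewrite (emb_pos completionA) -el -(raddfB j).
pose G := [set g | exists n, minorants j (v n) g].
have G0 : G !=set0 by have [g hg] := minorants_neq0 j (v0 0%N); exists g, 0%N.
have sG : supremums (i @` G) s.
  split=> [_ [g [n hg] <-]|t ht].
    apply: (@le_trans _ _ (u_to_s i j (v n))); last by case: hs => h1 _; apply: h1; exists n.
    by have [h1 _] := u_to_s_sups j hS (v0 n); apply: h1; exists g.
  case: hs => _; apply => _ [n _ <-]; have [_] := u_to_s_sups j hS (v0 n); apply.
  by move=> _ [g hg <-]; apply: ht; exists g => //; exists n.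
have Gd g : G g -> rmeet (rpos (g - lam *: e)) (e - q) = 0.
  move=> [n [g0 gv]]; apply: (uc_inj completionA); rewrite (emb_meet completionA) jpos jd raddf0.
  apply: (rmeet0_le (rpos_ge0 _) _ _ (lexx _) (vd n)); rewrite ?rsub_ge0//.
  by apply: rpos_mono; rewrite rleD2r.
have sd g : below i s g -> rmeet (rpos (g - lam *: e)) (e - q) = 0.
  move=> [g0 gs]; have sg := sc_sup_meet hS G0 sG gs.
  have X0 : [set rmeet g a | a in G] !=set0 by have [x Gx] := G0; exists (rmeet g x), x.
  have sg1 := sups_addr (- (lam *: e)) sg.
  have X1 : [set x + - (lam *: e) | x in [set rmeet g a | a in G]] !=set0.
    by have [x hx] := X0; exists (x - lam *: e), x.
  apply: (sup_meet0 (sups_join 0 X1 sg1)).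
    by have [x hx] := X1; exists (rjoin x 0), x.
  move=> _ [_ [_ [x Gx <-] <-] <-].
  apply: (rmeet0_le (rpos_ge0 _) d0 _ (lexx _) (Gd _ Gx)).
  by apply: rpos_mono; rewrite rleD2r rmeet_ler.
have B0 : below i s !=set0.
  exists 0; split=> //; have [g hg] := minorants_neq0 j (v0 0%N).
  have [h1 _] := sG; apply: h1; exists 0 => //; exists 0%N; split; rewrite ?raddf0//.
apply: band_proj_le => // g [g0 gex]; split=> //.
pose X := [set rpos (g - lam *: e) | g in below i s].
have X0 : X !=set0 by have [x hx] := B0; exists (rpos (x - lam *: e)), x.
have sX : supremums (i @` X) (excess i e s lam).
  rewrite /excess.
  have -> : [set i (rpos (g - lam *: e)) | g in below i s] = i @` X by rewrite image_comp.
  by apply: (sc_sups hS); have [x hx] := X0; exists (i x), x.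
apply: (sc_disjoint X0 sX) => // _ [x hx <-]; split; first exact: rpos_ge0.
exact: sd.
Qed.

(** * The weak type inequalities *)

Section Martingale.
Variable f : nat -> A.
Hypotheses (hf : martingale i j T f) (hbd : L1_bounded i j T f).
Local Notation norm := (norm1 i j T f).

Lemma norm_ge n v : expect baseL (tau 0%N) (rabs (f n)) v -> v <= norm.
Proof.
move=> hv; have : sup_in (L1 i j (T 0%N)) (L1_norms i j T f) norm.
  by rewrite /norm1; case: xgetP => [y _ //|hn]; case: hbd => y /hn.
move=> [_ hub _]; apply: hub; exists n => //.
exact: (ext_pos (rabs_ge0 _) hv).
Qed.

(** Up to time N the martingale is the difference of the positive martingales
   closed by the positive and the negative part of its value at N. *)
Lemma positive_martingales N : exists (a b : nat -> A) (vu vw : A),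
  [/\ expect baseL (tau 0%N) (rpos (f N)) vu /\ expect baseL (tau 0%N) (rneg (f N)) vw,
      forall n, expect baseL (tau n) (rpos (f N)) (a n),
      forall n, expect baseL (tau n) (rneg (f N)) (b n),
      forall n, (n <= N)%N -> f n = a n - b n & vu + vw <= norm].
Proof.
have [v hv] := L1_expect (mart_L1 hf N).
have p0 := rpos_ge0 (f N); have n0 := rneg_ge0 (f N).
have pa : rpos (f N) <= rabs (f N) by rewrite rabs_posneg rle_addr.
have na : rneg (f N) <= rabs (f N) by rewrite rabs_posneg rle_addl.
have [vu hvu] := expect_le_exists p0 pa hv.
have [vw hvw] := expect_le_exists n0 na hv.
have tw n x : baseL x -> tau 0%N (tau n x) = tau 0%N x by apply: tau_tower.
have exa n := expect_exists dedA latA baseL_dense (tau_cexp 0%N) (tau_cexp n) (tw n) p0 hvu.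
have exb n := expect_exists dedA latA baseL_dense (tau_cexp 0%N) (tau_cexp n) (tw n) n0 hvw.
pose a n := sval (cid (exa n)); pose b n := sval (cid (exb n)).
have ha n : expect baseL (tau n) (rpos (f N)) (a n) := svalP (cid (exa n)).
have hb n : expect baseL (tau n) (rneg (f N)) (b n) := svalP (cid (exb n)).
exists a, b, vu, vw; split=> //.
  by move=> n nN; rewrite -(mart_proj hf nN); apply: ext_signed.
have := expectD dedA baseL_dense (tau_cexp 0%N) p0 n0 hvu hvw.
by rewrite -rabs_posneg => /norm_ge.
Qed.

Lemma weak_type_maximal (lam : R) : 0 < lam ->
  lam *: j (T 0%N (band_proj_s i (excess i e (maximal_fun i j f) lam) e)) <= 3 *: norm.
Proof.
move=> lam0; apply: weak_type_sup => // [n|N]; first exact: rabs_ge0.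
have [a [b [vu [vw [[hvu hvw] ha hb hab hn]]]]] := positive_martingales N.
have p0 := rpos_ge0 (f N); have n0 := rneg_ge0 (f N).
exists (1 - survive a b lam N); split.
- exact/idemC/(survive_idem dedA).
- have wm := weak_maximal dedA baseL_dense tau_cexp tau_tower tau_tower' p0 n0 hvu hvw ha hb
    lam0 N.
  apply: (le_trans wm); apply: (le_trans hn).
  have c0 : 0 <= norm.
    apply: le_trans hn; apply: raddr_ge0.
      exact: (expect_ge0 baseL_dense (tau_cexp 0%N) p0 hvu).
    exact: (expect_ge0 baseL_dense (tau_cexp 0%N) n0 hvw).
  by rewrite -{1}(scale1r norm); apply: rscale_le2 => //; rewrite ler1n.
move=> n nN; have qi := idem_ge0 (survive_idem dedA a b lam N).
rewrite subKr; apply/le_anti/andP; split; last by apply: fmul_ge0; rewrite ?rpos_ge0.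
rewrite -(survive_stop dedA a b lam nN); apply: fle_mull => //; apply: rpos_mono;
  rewrite rleD2r hab//.
have an := expect_ge0 baseL_dense (tau_cexp n) p0 (ha n).
have bn := expect_ge0 baseL_dense (tau_cexp n) n0 (hb n).
rewrite rabs_le opprB; apply/andP; split; first by rewrite rleD2l -rsub_ge0 opprK raddr_ge0.
by rewrite addrC rleD2r -rsub_ge0 opprK raddr_ge0.
Qed.

(** Where v exceeds lam, v^2 - lam^2 = (v - lam) (v + lam) is at least
   lam (v - lam). *)
Lemma sqr_excess (v w : A) (lam : R) : 0 < lam -> 0 <= v -> v * v <= w ->
  (1 - chi (w - sc (lam * lam))) * rpos (v - sc lam) = 0.
Proof.
move=> lam0 v0 vw; set c := chi _; set l := sc lam.
have c0 : 0 <= 1 - c by apply/idem_ge0/idemC/(chi_idem dedA).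
have r0 : 0 <= rpos (v - l) by apply: rpos_ge0.
have cr0 : 0 <= (1 - c) * rpos (v - l) by apply: fmul_ge0.
have h1 : (1 - c) * (w - sc (lam * lam)) <= 0 by apply: (chiC_mul_le0 dedA).
have rho0 := chi_ge0 dedA (v - l).
have h2 : l * ((1 - c) * rpos (v - l)) <= 0.
  rewrite -(mulr0 (chi (v - l))).
  apply: (@le_trans _ _ (chi (v - l) * ((1 - c) * (w - sc (lam * lam))))); last exact: fle_mull.
  apply: (@le_trans _ _ (chi (v - l) * ((1 - c) * (v * v - sc (lam * lam))))); last first.
    by do 2!apply: fle_mull => //; rewrite rleD2r.
  rewrite fconstM -/l.
  have -> : chi (v - l) * ((1 - c) * (v * v - l * l)) = (1 - c) * (chi (v - l) * (v - l)) * (v +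
    l).
    by ring.
  by rewrite (chi_mul dedA) mulrC; apply: fle_mull => //; apply: rle_addl.
apply/le_anti; rewrite cr0 andbT.
by rewrite -(rscale_le _ _ lam0) scaler0 fscaleE.
Qed.

Lemma sqsum_sum (a b : nat -> A) N n : (n <= N)%N ->
  (forall n, (n <= N)%N -> f n = a n - b n) ->
  \sum_(k < n.+1) mul (mdiff f k) (mdiff f k) = sqsum a b n :> A.
Proof.
move=> nN hab; elim: n nN => [|n IH] nN.
  by rewrite big_ord1 /= /mdiff hab.
by rewrite big_ord_recr /= IH ?(ltnW nN)// /mdiff !hab// ltnW.
Qed.

Lemma weak_type_square (lam : R) : 0 < lam ->
  lam *: j (T 0%N (band_proj_s i (excess i e (square_fun i j mul f) lam) e)) <= 3 *: norm.
Proof.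
move=> lam0.
pose w n := \sum_(k < n.+1) mul (mdiff f k) (mdiff f k) : A.
(* the value 0 stands for a missing square root *)
have sq n : 0 <= rsqrt mul (w n) /\ (rsqrt mul (w n) = 0 \/ mul (rsqrt mul (w n)) (rsqrt mul (w
  n)) = w n).
  by rewrite /rsqrt; case: xgetP => [y _ [y0 yy]|_]; split => //; [right | left].
apply: weak_type_sup => // [n|N]; first by case: (sq n).
have [a [b [vu [vw [[hvu hvw] ha hb hab hn]]]]] := positive_martingales N.
have p0 := rpos_ge0 (f N); have n0 := rneg_ge0 (f N).
have iq := survive_idem dedA a b lam N.
set c := chi (sqsum a b N - sc (lam * lam)).
have ic : idem c by apply: (chi_idem dedA).
exists (1 - survive a b lam N * (1 - c)); split.
- by apply/idemC/idemM => //; apply: idemC.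
- have ws := weak_square dedA baseL_dense tau_cexp tau_tower tau_tower' p0 n0 hvu hvw ha hb lam0
    N.
  by apply: (le_trans ws); rewrite rscale_le.
move=> n nN; rewrite subKr -mulrA.
suff -> : (1 - c) * rpos (rsqrt mul (w n) - sc lam) = 0 by rewrite mulr0.
have [s0 hs] := sq n.
apply: sqr_excess => //.
have sm m k : sqsum a b m <= sqsum a b (m + k).
  elim: k => [|k IH]; rewrite ?addn0// addnS /=; apply: (le_trans IH).
  by apply: rle_addr; apply: fsqr_ge0.
apply: (@le_trans _ _ (sqsum a b n)); last by rewrite -(subnKC nN).
have ew : w n = sqsum a b n := sqsum_sum nN hab.
rewrite -ew; case: hs => [->|hs]; first by rewrite mulr0 ew sqsum_ge0.
by rewrite -[X in _ <= X]hs.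
Qed.

End Martingale.
End Main.

Theorem corollary4p7 (R : realType) (E : rieszType R) (e : E)
    (hE : dedekind_complete [set: E]) (he : weak_order_unit e)
    (U : rieszType R) (j : {linear E -> U}) (hU : universal_completion j)
    (mul : U -> U -> U) (hmul : f_algebra mul (j e))
    (S : orderedConeType R) (i : E -> S) (hS : sup_completion i)
    (T : nat -> {linear E -> E}) (hT : filtration e T) :
  exists C : R, 0 < C /\
    forall f : nat -> U, martingale i j T f -> L1_bounded i j T f ->
    forall lambda : R, 0 < lambda ->
      lambda *: j (T 0%N
          (band_proj_s i (excess i e (maximal_fun i j f) lambda) e))
        <= C *: norm1 i j T f
      /\
      lambda *: j (T 0%N
          (band_proj_s i (excess i e (square_fun i j mul f) lambda) e))
        <= C *: norm1 i j T f.
Proof.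
exists 3; split=> // f hf hbd lambda lambda0; split.
- apply: (@weak_type_maximal _ _ _ hE he _ _ hU _ hmul _ _ hS _ hT f) => //.
  by case: hf => *; split.
apply: (@weak_type_square _ _ _ hE he _ _ hU _ hmul _ _ hS _ hT f) => //.
by case: hf => *; split.
Qed.
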